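(* Let $P(z)\in\mathbb{F}[z]^{m\times n}$ be a matrix polynomial of grade $k\ge 2$, let $v(z)=\omega^TV(z)$ be a scalar ansatz polynomial of grade $k-1$, where $\omega\in\mathbb{F}^k$ and $V(z)=[z^{k-1},\dots,z,1]^T$, and let $L(z)=\mathbb{DL}(P,v)\in\mathbb{F}[z]^{km\times kn}$. Suppose that the set of eigenvalues of $P(z)$ and the set of roots of $v(z)$, each including possibly infinite eigenvalues or roots, are disjoint. Let $\{\rho_i(z)\}_{i=1}^t$ be a maximal set of root polynomials at $\lambda\in\mathbb{F}$ for $L(z)$ and define $r_i(z)=(\omega^T\otimes I_n)\rho_i(z)$ for $i=1,\dots,t$. Then $\{r_i(z)\}_{i=1}^t$ is a maximal set of root polynomials at $\lambda$ for $P(z)$.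
   Context: $\mathbb{F}$ is an algebraically closed field of characteristic $0$. A (matrix or scalar) polynomial of grade $g$ is a polynomial of degree at most $g$. An ansatz polynomial of grade $k-1$ is a nonzero scalar polynomial in $\mathbb{F}[z]$ of degree at most $k-1$. Pencil $\mathbb{DL}(P,v)$: with $V(x)=[x^{k-1},\dots,x,1]^T$, it is the unique $L(z)=zL_1+L_0\in\mathbb{F}[z]^{km\times kn}$ such that $$(V(y)^T\otimes I_m)\,L(z)\,(V(x)\otimes I_n)=\frac{P(y)(x-z)v(x)-P(x)(y-z)v(y)}{x-y}.$$ $\lambda\in\mathbb{F}$ is an eigenvalue of $P(z)$ if $\operatorname{rank}P(\lambda)<\operatorname{rank}P(z)$ (the latter rank over $\mathbb{F}(z)$); $\infty$ is an eigenvalue of $P(z)$ of grade $k$ if $0$ is an eigenvalue of $z^kP(z^{-1})$. $v$ of grade $k-1$ has a root at $\infty$ iff $\deg v<k-1$. A right minimal basis of a matrix polynomial $Q(z)\in\mathbb{F}[z]^{a\times b}$ is a matrix polynomial $M(z)$ whose columns form a basis of $\ker Q(z)=\{x(z)\in\mathbb{F}(z)^b:Q(z)x(z)=0\}$ over $\mathbb{F}(z)$ with minimal sum of column degrees among polynomial bases. For $\lambda\in\mathbb{F}$, $\ker_\lambda Q(z)\subseteq\mathbb{F}^b$ is the span of the columns of $M(\lambda)$ (independent of the choice of $M$). A vector $r(z)\in\mathbb{F}[z]^b$ is a root polynomial at $\lambda$ of order $\ell\ge1$ for $Q(z)$ if $Q(z)r(z)=(z-\lambda)^\ell w(z)$ with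 $w(z)$ a polynomial vector, $w(\lambda)\ne0$, and $r(\lambda)\notin\ker_\lambda Q(z)$. A set $\{r_i(z)\}_{i=1}^t$ of root polynomials at $\lambda$ for $Q(z)$ with orders $\ell_1\ge\dots\ge\ell_t$ is $\lambda$-independent if $[M(\lambda)\ r_1(\lambda)\ \cdots\ r_t(\lambda)]$ has full column rank; complete if it is $\lambda$-independent and $t=\dim\ker Q(\lambda)-\dim\ker_\lambda Q(z)$; maximal if it is complete and, for each $i=1,\dots,t$, there is no root polynomial $\hat r(z)$ at $\lambda$ for $Q(z)$ such that $r_1(z),\dots,r_{i-1}(z),\hat r(z)$ are $\lambda$-independent and the order of $\hat r(z)$ is strictly larger than that of $r_i(z)$. *)

(* Defs.v *)
From HB Require Import structures.
From mathcomp Require Import all_boot all_order all_algebra.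
From mathcomp Require Import mxtens.

Set Implicit Arguments.
Unset Strict Implicit.
Unset Printing Implicit Defensive.

Import GRing.Theory.
Local Open Scope ring_scope.

(* [u \otimes I_n] for a column and for a row [u]; the casts only replace the
   dimension [1 * n] produced by the Kronecker product [*t] by [n]. *)
Definition kron_col (R : comNzRingType) (k n : nat) (u : 'cV[R]_k) :
    'M[R]_(k * n, n) :=
  castmx (erefl (k * n)%N, mul1n n) (u *t (1%:M : 'M[R]_n)).

Definition kron_row (R : comNzRingType) (k n : nat) (u : 'rV[R]_k) :
    'M[R]_(n, k * n) :=
  castmx (mul1n n, erefl (k * n)%N) (u *t (1%:M : 'M[R]_n)).

(* V(x) = [x^(k-1), ..., x, 1]^T *)
Definition Vvec (R : comNzRingType) (k : nat) (x : R) : 'cV[R]_k :=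
  \col_(i < k) x ^+ (k - i.+1).

Section MatrixPolynomials.

Variable F : fieldType.

Definition has_grade (g m n : nat) (P : 'M[{poly F}]_(m, n)) : Prop :=
  forall i j, (size (P i j) <= g.+1)%N.

Definition mxconst (m n : nat) (A : 'M[F]_(m, n)) : 'M[{poly F}]_(m, n) :=
  map_mx polyC A.

Definition mxeval (m n : nat) (P : 'M[{poly F}]_(m, n)) (lam : F) :
    'M[F]_(m, n) :=
  map_mx (fun p : {poly F} => p.[lam]) P.

Definition mxfrac (m n : nat) (P : 'M[{poly F}]_(m, n)) :
    'M[{fraction {poly F}}]_(m, n) :=
  map_mx (@tofrac {poly F}) P.

(* z^g P(z^-1) *)
Definition mxrev (g m n : nat) (P : 'M[{poly F}]_(m, n)) :
    'M[{poly F}]_(m, n) :=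
  map_mx (fun p : {poly F} => \poly_(i < g.+1) p`_(g - i)) P.

Definition finite_eigenvalue (m n : nat) (P : 'M[{poly F}]_(m, n)) (lam : F) :
    bool :=
  (\rank (mxeval P lam) < \rank (mxfrac P))%N.

(* Elements of F together with infinity are encoded by [option F], with
   [None] standing for infinity. *)
Definition poly_eigenvalue (g m n : nat) (P : 'M[{poly F}]_(m, n))
    (mu : option F) : bool :=
  if mu is Some lam then finite_eigenvalue P lam
  else finite_eigenvalue (mxrev g P) 0.

(* Roots of a nonzero scalar polynomial [v] of grade [g]; the clause for
   infinity is [deg v < g], where [deg v = (size v).-1]. *)
Definition grade_root (g : nat) (v : {poly F}) (mu : option F) : bool :=
  if mu is Some lam then root v lam else ((size v).-1 < g)%N.

(* The ring F[x][y][z], in which the identity defining DL(P, v) is stated. *)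
Definition poly3 := {poly {poly {poly F}}}.
Definition Xx : poly3 := ('X%:P)%:P.
Definition Xy : poly3 := 'X%:P.
Definition Xz : poly3 := 'X.
Definition const3 (a : F) : poly3 := ((a%:P)%:P)%:P.

Definition psubst (s : poly3) (p : {poly F}) : poly3 :=
  (map_poly const3 p).[s].

Definition mxsubst (m n : nat) (s : poly3) (P : 'M[{poly F}]_(m, n)) :
    'M[poly3]_(m, n) :=
  map_mx (psubst s) P.

(* [L] is the pencil DL(P, v); the denominator [x - y] of the defining identity
   is cleared, which loses nothing since [poly3] is an integral domain. *)
Definition isDL (k m n : nat) (P : 'M[{poly F}]_(m, n)) (v : {poly F})
    (L : 'M[{poly F}]_(k * m, k * n)) : Prop :=
  (exists L1 L0 : 'M[F]_(k * m, k * n),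
     L = 'X *: mxconst L1 + mxconst L0) /\
  (Xx - Xy) *:
    (kron_row m (Vvec k Xy)^T *m mxsubst Xz L *m kron_col n (Vvec k Xx))
  = ((Xx - Xz) * psubst Xx v) *: mxsubst Xy P
    - ((Xy - Xz) * psubst Xy v) *: mxsubst Xx P.

Section RootPolynomials.

Variables (a b : nat) (Q : 'M[{poly F}]_(a, b)).

(* The columns of [M] form a basis of the kernel of [Q] over F(z).  MathComp's
   [kermx] and row spaces act on row vectors, hence the transpositions. *)
Definition ker_poly_basis (p : nat) (M : 'M[{poly F}]_(b, p)) : bool :=
  row_free (mxfrac M)^T && ((mxfrac M)^T == kermx (mxfrac Q)^T)%MS.

Definition col_degree (p : nat) (M : 'M[{poly F}]_(b, p)) (j : 'I_p) : nat :=
  \max_(i < b) (size (M i j)).-1.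

Definition right_minimal_basis (p : nat) (M : 'M[{poly F}]_(b, p)) : Prop :=
  ker_poly_basis M /\
  forall M' : 'M[{poly F}]_(b, p), ker_poly_basis M' ->
    (\sum_(j < p) col_degree M j <= \sum_(j < p) col_degree M' j)%N.

Variable lam : F.

(* In the next definitions [M] is meant to be a right minimal basis of [Q],
   so that ker_lam Q is the column span of [mxeval M lam]. *)
Section WithBasis.

Variables (p : nat) (M : 'M[{poly F}]_(b, p)).

Definition in_ker_at (u : 'cV[F]_b) : bool := (u^T <= (mxeval M lam)^T)%MS.

Definition root_poly (l : nat) (r : 'cV[{poly F}]_b) : Prop :=
  [/\ (1 <= l)%N,
      exists2 w : 'cV[{poly F}]_a,
        Q *m r = ('X - lam%:P) ^+ l *: w & mxeval w lam != 0
    & ~~ in_ker_at (mxeval r lam)].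

(* [M(lam) r_1(lam) ... r_t(lam)] has full column rank *)
Definition lam_independent (rs : seq 'cV[{poly F}]_b) : bool :=
  \rank (row_mx (mxeval M lam)
    (\matrix_(i < b, j < size rs) mxeval (nth 0 rs j) lam i 0))
  == (p + size rs)%N.

Definition ordered_root_polys (ls : seq nat) (rs : seq 'cV[{poly F}]_b) :
    Prop :=
  [/\ size ls = size rs, sorted geq ls
    & forall i, (i < size rs)%N -> root_poly (nth 0%N ls i) (nth 0 rs i)].

(* t = dim ker Q(lam) - dim ker_lam Q, written without truncated subtraction *)
Definition complete_root_polys (rs : seq 'cV[{poly F}]_b) : Prop :=
  lam_independent rs /\
  (size rs + \rank (mxeval M lam))%N = \rank (kermx (mxeval Q lam)^T).

Definition maximal_orders (ls : seq nat) (rs : seq 'cV[{poly F}]_b) : Prop :=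
  forall i, (i < size rs)%N ->
    ~ exists (l : nat) (r : 'cV[{poly F}]_b),
        [/\ root_poly l r, lam_independent (rcons (take i rs) r)
          & (nth 0%N ls i < l)%N].

End WithBasis.

(* The choice of the right minimal basis is immaterial, because its column
   span at [lam] does not depend on it. *)
Definition maximal_root_polys (rs : seq 'cV[{poly F}]_b) : Prop :=
  exists (p : nat) (M : 'M[{poly F}]_(b, p)) (ls : seq nat),
    [/\ right_minimal_basis M, ordered_root_polys M ls rs,
        complete_root_polys M rs & maximal_orders M ls rs].

End RootPolynomials.

End MatrixPolynomials.

(* Main.v *)
Require Import Defs.
From Stdlib Require Import Classical.
From mathcomp Require Import all_boot all_order all_algebra.
From mathcomp Require Import zify ring.
From mathcomp Require Import mxtens separable.

(* Fix z = mu and put u(x) = (x - mu) v(x).  Then L(mu) is the Bezoutian matrix of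
   P(x) and u(x), and everything rests on the two rank bounds
     rank L(mu) >= rank P(mu) + (k - 1) rank P   and   rank L <= k rank P.
   For the first one, a vector c in ker L(mu) is encoded by a polynomial vector h
   with deg h < deg u and u | P h; dividing out the roots of u one at a time
   bounds the number of such h by the sum of dim ker P(alpha) over these roots,
   and the defect k - deg u is treated in the same way with the reversal of P at
   0.  The second bound is clear when u has k simple roots, since L(mu) is then a
   sum of k matrices factoring through some P(alpha), and it follows in general
   by perturbing u.
   Writing Phi = omega^T (x) I, Psi = V^T (x) I, Pi = V (x) I, Omega = omega (x) I,
   one has Psi L = P Phi, L Pi = Omega P and Phi Pi = v I.  If v(lam) <> 0, the rank
   bounds show that a vector of ker L(lam) lies in ker_lam L as soon as Phi(lam)
   sends it into ker_lam P.  Thus Phi preserves lam-independence, while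
   x |-> v(lam)^-1 Pi x lifts root polynomials of P to root polynomials of L of
   the same order, so that maximality passes from L to P.  If v(lam) = 0, then lam
   is an eigenvalue of neither P nor L, and both maximal sets are empty. *)

Set Implicit Arguments.
Unset Strict Implicit.
Unset Printing Implicit Defensive.

Import GRing.Theory.
Local Open Scope ring_scope.

(** * Minors, evaluation and rank *)

Section Minors.
Variable K : fieldType.

Lemma rank_rowsub (m n s : nat) (f : 'I_s -> 'I_m) (A : 'M[K]_(m, n)) :
  (\rank (rowsub f A) <= \rank A)%N.
Proof.
apply: mxrankS; apply/row_subP => i.
by rewrite row_rowsub row_sub.
Qed.

Lemma rank_mxsub_unit (m n s : nat) (f : 'I_s -> 'I_m) (g : 'I_s -> 'I_n)
    (A : 'M[K]_(m, n)) :
  mxsub f g A \in unitmx -> (s <= \rank A)%N.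
Proof.
move=> /mxrank_unit {1}<-.
have -> : mxsub f g A = rowsub f (rowsub g A^T)^T.
  by apply/matrixP => i j; rewrite !mxE.
rewrite (leq_trans (rank_rowsub _ _)) // mxrank_tr.
by rewrite (leq_trans (rank_rowsub _ _)) ?mxrank_tr.
Qed.

(** Choose a maximal free family of rows, then of columns of the result. Such minors transport ranks
    between a polynomial matrix and its values, as determinants commute with evaluation. *)
Lemma unit_minor (m n : nat) (A : 'M[K]_(m, n)) :
  exists (f : 'I_(\rank A) -> 'I_m) (g : 'I_(\rank A) -> 'I_n),
    mxsub f g A \in unitmx.
Proof.
have full : row_full (rowsub (maxrankfun A) A)^T.
  by rewrite /row_full mxrank_tr; exact: maxrowsub_free.
exists (maxrankfun A), (fullrankfun full).
have -> : mxsub (maxrankfun A) (fullrankfun full) A =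
    (rowsub (fullrankfun full) (rowsub (maxrankfun A) A)^T)^T.
  by apply/matrixP => i j; rewrite !mxE.
by rewrite unitmx_tr fullrowsub_unit.
Qed.

Lemma mxrank_eq_colP (m n : nat) (A : 'M[K]_(m, n)) :
  \rank A = n <-> (forall x : 'cV_n, A *m x = 0 -> x = 0).
Proof.
rewrite -mxrank_tr; split=> [rA x Ax0 | inj].
  have/row_freeP[B AB1] : row_free A^T by apply/eqP.
  have: B^T *m A = 1%:M by rewrite -[A]trmxK -trmx_mul AB1 trmx1.
  by move=> BA; rewrite -[x]mul1mx -BA -mulmxA Ax0 mulmx0.
apply/eqP; rewrite -[_ == _]/(row_free A^T) -kermx_eq0.
apply/eqP/row_matrixP => i; rewrite row0.
have: row i (kermx A^T) *m A^T = 0 by apply/sub_kermxP/row_sub.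
move/(congr1 trmx); rewrite trmx_mul trmxK trmx0 => /inj/(congr1 trmx).
by rewrite trmxK trmx0.
Qed.

End Minors.

(** * Polynomial matrices and their values at points of the field *)

Section Evaluation.
Variable F : closedFieldType.
Implicit Types (p q : {poly F}).

Lemma eq_horner p q : (forall x, p.[x] = q.[x]) -> p = q.
Proof.
move=> eq_pq; apply/eqP; rewrite -subr_eq0; apply/negPn/negP.
by move=> /closed_nonrootP[x]; rewrite rootE !hornerE eq_pq subrr eqxx.
Qed.

Lemma mxevalM (m n s : nat) (A : 'M[{poly F}]_(m, n)) (B : 'M_(n, s)) x :
  mxeval (A *m B) x = mxeval A x *m mxeval B x.
Proof. exact: (map_mxM (horner_eval x)). Qed.

Lemma mxevalZ (m n : nat) p (A : 'M[{poly F}]_(m, n)) x :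
  mxeval (p *: A) x = p.[x] *: mxeval A x.
Proof. exact: (map_mxZ (horner_eval x)). Qed.

Lemma mxeval_const (m n : nat) (A : 'M[F]_(m, n)) x : mxeval (mxconst A) x = A.
Proof. by apply/matrixP => i j; rewrite !mxE hornerC. Qed.

Lemma mxconstM (m n s : nat) (A : 'M[F]_(m, n)) (B : 'M_(n, s)) :
  mxconst (A *m B) = mxconst A *m mxconst B.
Proof. exact: (map_mxM polyC). Qed.

Lemma eq_mxeval (m n : nat) (A B : 'M[{poly F}]_(m, n)) :
  (forall x, mxeval A x = mxeval B x) -> A = B.
Proof.
move=> eqAB; apply/matrixP => i j; apply: eq_horner => x.
by have /matrixP/(_ i j) := eqAB x; rewrite !mxE.
Qed.

Lemma scale_polymxI (m n : nat) p (A B : 'M[{poly F}]_(m, n)) :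
  p != 0 -> p *: A = p *: B -> A = B.
Proof.
move=> p0 eqAB; apply/matrixP => i j; apply: (mulfI p0).
by have /matrixP/(_ i j) := eqAB; rewrite !mxE.
Qed.

Lemma polymx_divX (m n : nat) (A : 'M[{poly F}]_(m, n)) x :
  mxeval A x = 0 ->
  A = ('X - x%:P) *: map_mx (fun p => p %/ ('X - x%:P)) A.
Proof.
move=> A0; apply/matrixP => i j; rewrite !mxE mulrC divpK // dvdp_XsubCl.
by have /matrixP/(_ i j) := A0; rewrite !mxE rootE => ->.
Qed.

Lemma det_mxeval (n : nat) (A : 'M[{poly F}]_n) x :
  \det (mxeval A x) = (\det A).[x].
Proof. exact: (det_map_mx (horner_eval x)). Qed.

Lemma rank_mxeval_le (m n : nat) (A : 'M[{poly F}]_(m, n)) x :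
  (\rank (mxeval A x) <= \rank (mxfrac A))%N.
Proof.
have [f [g]] := unit_minor (mxeval A x); rewrite unitmxE unitfE => det_nz.
apply: (@rank_mxsub_unit _ _ _ _ f g).
have -> : mxsub f g (mxfrac A) = mxfrac (mxsub f g A).
  by apply/matrixP => i j; rewrite !mxE.
rewrite unitmxE unitfE det_map_mx tofrac_eq0; apply: contraNneq det_nz => det0.
have -> : mxsub f g (mxeval A x) = mxeval (mxsub f g A) x.
  by apply/matrixP => i j; rewrite !mxE.
by rewrite det_mxeval det0 horner0.
Qed.

(** The generic rank is attained wherever one fixed maximal minor is nonzero; the factor [d] allows
    finitely many further points to be avoided. *)
Lemma rank_mxfrac_eval (m n : nat) (A : 'M[{poly F}]_(m, n)) d :
  d != 0 -> exists2 x, d.[x] != 0 & \rank (mxeval A x) = \rank (mxfrac A).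
Proof.
move=> d0; have [f [g]] := unit_minor (mxfrac A).
have -> : mxsub f g (mxfrac A) = mxfrac (mxsub f g A).
  by apply/matrixP => i j; rewrite !mxE.
rewrite unitmxE unitfE det_map_mx tofrac_eq0 => det_nz.
have /closed_nonrootP[x] : d * \det (mxsub f g A) != 0 by rewrite mulf_neq0.
rewrite rootE hornerM mulf_eq0 negb_or => /andP[dx detx]; exists x => //.
apply/eqP; rewrite eqn_leq rank_mxeval_le /=.
apply: (@rank_mxsub_unit _ _ _ _ f g).
have -> : mxsub f g (mxeval A x) = mxeval (mxsub f g A) x.
  by apply/matrixP => i j; rewrite !mxE.
by rewrite unitmxE unitfE det_mxeval.
Qed.

(** Induction on [zs]: combinations of columns of [H] that vanish at [z] are divisible by
    ['X - z%:P], and restricting to them costs at most the nullity of [P(z)], because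
    [P(z) H(z) = 0]. Each division lowers the size bound by one, so nothing is left once [zs] is
    exhausted. *)
Lemma kernel_mod_prod_XsubC (m n s : nat) (P : 'M[{poly F}]_(m, n))
    (zs : seq F) (H : 'M[{poly F}]_(n, s)) (W : 'M[{poly F}]_(m, s)) :
  (forall i j, (size (H i j) <= size zs)%N) ->
  P *m H = (\prod_(z <- zs) ('X - z%:P)) *: W ->
  exists N : 'M[F]_s, H *m mxconst N = 0 /\
    (s <= \rank N + \sum_(z <- zs) (n - \rank (mxeval P z)))%N.
Proof.
elim: zs H W => [|z zs IH] H W sizeH PH.
  exists 1%:M; rewrite mxrank1 big_nil addn0; split=> //.
  suff -> : H = 0 by rewrite mul0mx.
  apply/matrixP => i j; apply/eqP; rewrite mxE -size_poly_eq0 -leqn0.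
  exact: sizeH.
pose N0 := cokermx (mxeval H z).
pose H1 := map_mx (fun p => p %/ ('X - z%:P)) (H *m mxconst N0).
have HN0 : H *m mxconst N0 = ('X - z%:P) *: H1.
  by apply: polymx_divX; rewrite mxevalM mxeval_const mulmx_coker.
have [||N1 [HN1 rN1]] := IH H1 (W *m mxconst N0).
- move=> i j; rewrite mxE size_divp ?polyXsubC_eq0 // size_XsubC leq_subLR.
  rewrite mxE; apply: (leq_trans (size_sum _ _ _)).
  apply/bigmax_leqP => l _; rewrite mxE mulrC mul_polyC.
  exact: leq_trans (size_scale_leq _ _) (sizeH _ _).
- apply: (@scale_polymxI _ _ ('X - z%:P)); first by rewrite polyXsubC_eq0.
  by rewrite scalemxAr -HN0 mulmxA PH big_cons scalerA scalemxAl.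
exists (N0 *m N1); split.
  by rewrite mxconstM mulmxA HN0 -scalemxAl HN1 scaler0.
have rN0 : \rank N0 = (s - \rank (mxeval H z))%N by rewrite mxrank_coker.
have rH : (\rank (mxeval P z) + \rank (mxeval H z) <= n)%N.
  apply: mulmx0_rank_max; rewrite -mxevalM PH mxevalZ big_cons hornerM.
  by rewrite hornerXsubC subrr mul0r scale0r.
have rHs := rank_leq_col (mxeval H z).
have rN01 := mxrank_mul_min N0 N1.
rewrite big_cons; lia.
Qed.

End Evaluation.

(** * Right minimal bases *)

Section Fractions.
Local Open Scope quotient_scope.

Lemma frac_numden (R : idomainType) (x : {fraction R}) :
  exists n d : R, d != 0 /\ tofrac d * x = tofrac n.
Proof.
elim/quotW: x => y; exists \n_y, \d_y; split; first exact: denom_ratioP.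
rewrite /tofrac; unlock FracField.tofrac; rewrite -[_ * _]/(FracField.mul _ _) !piE.
apply/eqmodP; rewrite /= FracField.equivfE /FracField.mulf.
by rewrite !numden_Ratio ?mul1r ?oner_eq0 ?denom_ratioP // mulr1 mulrC.
Qed.

End Fractions.

Section MinimalBases.
Variable F : closedFieldType.

Lemma mxfracM (m n s : nat) (A : 'M[{poly F}]_(m, n)) (B : 'M_(n, s)) :
  mxfrac (A *m B) = mxfrac A *m mxfrac B.
Proof. exact: map_mxM. Qed.

Lemma mxfracZ (m n : nat) (p : {poly F}) (A : 'M[{poly F}]_(m, n)) :
  mxfrac (p *: A) = tofrac p *: mxfrac A.
Proof. exact: map_mxZ. Qed.

Lemma mxfrac_inj (m n : nat) : injective (@mxfrac F m n).
Proof.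
move=> A B eqAB; apply/matrixP => i j; apply/eqP; rewrite -tofrac_eq.
by have /matrixP/(_ i j) := eqAB; rewrite !mxE => ->.
Qed.

Lemma mxfrac0 (m n : nat) : mxfrac (0 : 'M[{poly F}]_(m, n)) = 0.
Proof. exact: map_mx0. Qed.

Lemma mxfrac_clear_denominators (m n : nat) (A : 'M[{fraction {poly F}}]_(m, n)) :
  exists (d : {poly F}) (B : 'M[{poly F}]_(m, n)),
    d != 0 /\ tofrac d *: A = mxfrac B.
Proof.
have num_den (ij : 'I_m * 'I_n) : exists nd : {poly F} * {poly F},
    (nd.2 != 0) && (tofrac nd.2 * A ij.1 ij.2 == tofrac nd.1).
  have [x [d [d0 e]]] := frac_numden (A ij.1 ij.2).
  by exists (x, d); rewrite /= d0 e eqxx.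
pose nd ij := xchoose (num_den ij).
have ndP ij : (nd ij).2 != 0 /\ tofrac (nd ij).2 * A ij.1 ij.2 = tofrac (nd ij).1.
  by have /andP[? /eqP] := xchooseP (num_den ij).
exists (\prod_ij (nd ij).2).
exists (\matrix_(i, j) ((\prod_(ij | ij != (i, j)) (nd ij).2) * (nd (i, j)).1)).
split; first by apply/prodf_neq0 => ij _; case: (ndP ij).
apply/matrixP => i j; rewrite !mxE (bigD1 (i, j)) //= !tofracM mulrC mulrA.
by rewrite [A i j * _]mulrC (proj2 (ndP (i, j))) mulrC.
Qed.

Section Kernel.
Variables (a n p : nat) (Q : 'M[{poly F}]_(a, n)) (M : 'M[{poly F}]_(n, p)).

(** Denominators are cleared: polynomial kernel vectors are generated by [M] over polynomials, up to
    a nonzero factor [d]. *)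
Lemma ker_poly_basisP :
  ker_poly_basis Q M <->
  [/\ \rank (mxfrac M) = p, Q *m M = 0 &
    forall s (X : 'M[{poly F}]_(n, s)), Q *m X = 0 ->
      exists d (G : 'M[{poly F}]_(p, s)), d != 0 /\ d *: X = M *m G].
Proof.
split=> [/andP[freeM /andP[leMk lekM]] | [rM QM0 genM]].
  split.
  - by apply/eqP; rewrite -mxrank_tr.
  - apply: mxfrac_inj; rewrite mxfracM mxfrac0; apply: trmx_inj.
    by rewrite trmx_mul trmx0; apply/sub_kermxP.
  move=> s X QX0.
  have: ((mxfrac X)^T <= (mxfrac M)^T)%MS.
    apply: submx_trans lekM; apply/sub_kermxP.
    by rewrite -trmx_mul -mxfracM QX0 mxfrac0 trmx0.
  case/submxP => D eqX.
  have [d [G [d0 dD]]] := mxfrac_clear_denominators D^T.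
  exists d, G; split=> //; apply: mxfrac_inj; rewrite mxfracZ mxfracM -dD -scalemxAr.
  by congr (_ *: _); apply: trmx_inj; rewrite eqX trmx_mul trmxK.
apply/andP; split; first by rewrite /row_free mxrank_tr rM.
have leMk : ((mxfrac M)^T <= kermx (mxfrac Q)^T)%MS.
  by apply/sub_kermxP; rewrite -trmx_mul -mxfracM QM0 mxfrac0 trmx0.
rewrite leMk /=.
have [d [K [d0 dK]]] := mxfrac_clear_denominators (kermx (mxfrac Q)^T)^T.
have QK0 : Q *m K = 0.
  apply: mxfrac_inj; rewrite mxfracM mxfrac0 -dK -scalemxAr; apply: trmx_inj.
  by rewrite linearZ /= trmx_mul trmxK mulmx_ker scaler0 trmx0.
have [d' [G [d'0 dG]]] := genM _ _ QK0.
have c0 : tofrac d' * tofrac d != 0 by rewrite mulf_neq0 // tofrac_eq0.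
apply/submxP; exists ((tofrac d' * tofrac d)^-1 *: (mxfrac G)^T).
rewrite -scalemxAl -trmx_mul -mxfracM -dG mxfracZ -dK.
by rewrite scalerA linearZ /= trmxK scalerA mulVf // scale1r.
Qed.

Lemma ker_poly_basis_size :
  ker_poly_basis Q M -> p = (n - \rank (mxfrac Q))%N.
Proof.
case/andP => /eqP freeM /eqmxP eqM.
by rewrite -freeM eqM mxrank_ker mxrank_tr.
Qed.

End Kernel.

Lemma ker_poly_basis_exists (a n : nat) (Q : 'M[{poly F}]_(a, n)) :
  exists p (M : 'M[{poly F}]_(n, p)), ker_poly_basis Q M.
Proof.
pose K := kermx (mxfrac Q)^T.
have [d [M [d0 dM]]] := mxfrac_clear_denominators (row_base K)^T.
exists _, M.
have dF0 : tofrac d != 0 by rewrite tofrac_eq0.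
have eqM : ((mxfrac M)^T :=: K)%MS.
  rewrite -dM linearZ /= trmxK.
  by apply: eqmx_trans (eq_row_base K); apply: eqmx_scale.
apply/andP; split; first by rewrite /row_free eqM.
exact/eqmxP.
Qed.

(** Descent on the sum of column degrees from any polynomial basis; whether a better one exists is
    decided classically. *)
Lemma right_minimal_basis_exists (a n : nat) (Q : 'M[{poly F}]_(a, n)) :
  exists p (M : 'M[{poly F}]_(n, p)), right_minimal_basis Q M.
Proof.
have [p [M0 basisM0]] := ker_poly_basis_exists Q; exists p.
have [s le_s] := ubnP (\sum_(j < p) col_degree M0 j).
elim: s => // s IH in M0 basisM0 le_s *.
case: (classic (exists M' : 'M[{poly F}]_(n, p), ker_poly_basis Q M' /\
    (\sum_(j < p) col_degree M' j < \sum_(j < p) col_degree M0 j)%N)).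
  by case=> M' [basisM' lt_M']; apply: (IH M') => //; lia.
move=> noM'; exists M0; split=> // M' basisM'; rewrite leqNgt; apply/negP => ltM'.
by apply: noM'; exists M'.
Qed.

Lemma size_col_degree (n p : nat) (M : 'M[{poly F}]_(n, p)) i j :
  (size (M i j) <= (col_degree M j).+1)%N.
Proof.
have /= : _ := @leq_bigmax _ (fun i => (size (M i j)).-1) i.
by rewrite -/(col_degree M j); case: (size _).
Qed.

(* If [M(x) c = 0], then exchanging a column of highest degree in the support of
   [c] for [M c / (z - x)] yields another basis with smaller degree sum. *)
Lemma rank_minimal_basis (a n p : nat) (Q : 'M[{poly F}]_(a, n))
    (M : 'M[{poly F}]_(n, p)) x :
  right_minimal_basis Q M -> \rank (mxeval M x) = p.
Proof.
case=> basisM minM; apply/mxrank_eq_colP => c Mc0; apply/eqP/negPn/negP => c0.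
have [rM QM0 genM] := (ker_poly_basisP Q M).1 basisM.
have [j1 cj1] : exists j, c j 0 != 0.
  apply/existsP; apply: contraNT c0; rewrite negb_exists => /forallP c0.
  by apply/eqP/colP => j; rewrite mxE; apply/eqP/negPn/c0.
case: (@arg_maxnP _ j1 (fun j => c j 0 != 0) (col_degree M) cj1) => j0 cj0 maxj0.
pose y := M *m mxconst c.
have y0 : mxeval y x = 0 by rewrite mxevalM mxeval_const Mc0.
have [y1 yE] : exists y1, y = ('X - x%:P) *: y1.
  by eexists; exact: polymx_divX.
have yiE i : y1 i 0 * ('X - x%:P) = \sum_j M i j * (c j 0)%:P.
  have /matrixP/(_ i 0) := yE; rewrite [RHS]mxE mulrC => <-; rewrite mxE.
  by apply: eq_bigr => j _; rewrite mxE.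
pose M' := \matrix_(i, j) (if j == j0 then y1 i 0 else M i j).
(* [T] writes the old basis in terms of the new one, by solving [('X - x) y1 = M c] for column [j0]
   of [M]; hence [M'] also has rank [p]. *)
pose T := \matrix_(i, j) (if j == j0 then
    (if i == j0 then (c j0 0)^-1 *: ('X - x%:P) else (- (c i 0) / c j0 0)%:P)
  else (i == j)%:R).
have MT : M = M' *m T.
  apply/matrixP => i j; rewrite !mxE; case: (eqVneq j j0) => [->|jj0].
    rewrite (bigD1 j0) //= !mxE eqxx.
    rewrite -scalerAr yiE (bigD1 j0) //= scalerDr.
    rewrite [M i j0 * _]mulrC mul_polyC scalerA mulVf // scale1r.
    rewrite -addrA scaler_sumr -big_split /= big1 ?addr0 // => l lj0.
    rewrite !mxE eqxx (negPf lj0) mulNr polyCN mulrN [_ / _]mulrC polyCM.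
    by rewrite [M i l * (_ * _)]mulrCA -mul_polyC subrr.
  rewrite (bigD1 j) //= !mxE eqxx (negPf jj0) mulr1 big1 ?addr0 // => l lj.
  by rewrite !mxE (negPf jj0) (negPf lj) mulr0.
have QM'0 : Q *m M' = 0.
  have Qy1 : Q *m y1 = 0.
    apply: (@scale_polymxI _ _ _ ('X - x%:P)); first by rewrite polyXsubC_eq0.
    by rewrite scalemxAr -yE mulmxA QM0 mul0mx scaler0.
  apply/matrixP => i j; rewrite !mxE.
  case: (eqVneq j j0) => jj0.
    have /matrixP/(_ i 0) := Qy1; rewrite !mxE => Qi; rewrite -[RHS]Qi.
    by apply: eq_bigr => l _; rewrite mxE jj0 eqxx.
  have /matrixP/(_ i j) := QM0; rewrite !mxE => Qi; rewrite -[RHS]Qi.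
  by apply: eq_bigr => l _; rewrite mxE (negPf jj0).
have basisM' : ker_poly_basis Q M'.
  apply/ker_poly_basisP; split=> //.
    apply/eqP; rewrite eqn_leq rank_leq_col /=.
    by rewrite -{1}rM MT mxfracM mxrankM_maxl.
  move=> s X QX0; have [d [G [d0 dX]]] := genM _ X QX0.
  by exists d, (T *m G); rewrite mulmxA -MT.
have sizey1 i : (size (y1 i 0%R) <= col_degree M j0)%N.
  have [-> | y1i] := eqVneq (y1 i 0) 0; first by rewrite size_poly0.
  have := size_Mmonic y1i (monicXsubC x); rewrite size_XsubC addn2 /= => sz.
  rewrite -ltnS -sz yiE; apply: (leq_trans (size_sum _ _ _)); apply/bigmax_leqP => l _.
  rewrite mulrC mul_polyC.
  have [-> | cl] := eqVneq (c l 0) 0; first by rewrite scale0r size_poly0.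
  apply: (leq_trans (size_scale_leq _ _)).
  by apply: leq_trans (size_col_degree _ _ _) _; rewrite ltnS; exact: maxj0.
(* By [sizey1] the degree drops unless column [j0] has degree [0], where the truncated predecessor
   hides the gain. In that case [y1 = 0], and [M c = 0] contradicts independence over the rational
   functions. *)
have ltM' : (col_degree M' j0 < col_degree M j0)%N.
  rewrite ltnNge; apply/negP => leM.
  have degM'0 : (col_degree M' j0 <= (col_degree M j0).-1)%N.
    apply/bigmax_leqP => i _; rewrite mxE eqxx -!subn1.
    exact/leq_sub2r/sizey1.
  have deg0 : col_degree M j0 = 0%N.
    by move: (leq_trans leM degM'0); case: (col_degree M j0) => // l; rewrite ltnn.
  have y1_0 : y1 = 0.
    apply/matrixP => i j; rewrite [j]ord1 [RHS]mxE; apply/eqP.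
    by have := sizey1 i; rewrite deg0 leqn0 size_poly_eq0.
  have /mxrank_eq_colP/(_ (mxfrac (mxconst c))) := rM.
  rewrite -mxfracM -/y yE y1_0 scaler0 mxfrac0 => /(_ erefl)/matrixP/(_ j0 0).
  by rewrite !mxE => /eqP; rewrite tofrac_eq0 polyC_eq0 (negPf cj0).
have := minM M' basisM'; rewrite leqNgt => /negP; apply.
rewrite (bigD1 j0) //= [ltnRHS](bigD1 j0) //= -addSn leq_add //.
apply: eq_leq; apply: eq_bigr => j jj0; apply: eq_bigr => i _.
by rewrite mxE (negPf jj0).
Qed.

(** Write [d X = M G]. If [d(x) = 0], injectivity of [M(x)] forces [G(x) = 0], so a factor [z - x]
    cancels from [d] and [G]; repeating this leads to a [d] with [d(x)] nonzero. *)
Lemma kernel_eval_sub_basis (a n p s : nat) (Q : 'M[{poly F}]_(a, n))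
    (M : 'M[{poly F}]_(n, p)) (X : 'M[{poly F}]_(n, s)) x :
  right_minimal_basis Q M -> Q *m X = 0 ->
  exists G : 'M[F]_(p, s), mxeval X x = mxeval M x *m G.
Proof.
move=> minM QX0; have rMx := rank_minimal_basis x minM.
have [basisM _] := minM; have [_ _ genM] := (ker_poly_basisP Q M).1 basisM.
have [d [G [d0 dX]]] := genM _ X QX0.
have [l le_l] := ubnP (size d).
elim: l => // l IH in d G d0 dX le_l *.
have [dx0 | dx] := eqVneq d.[x] 0; last first.
  exists (d.[x]^-1 *: mxeval G x).
  by rewrite -scalemxAr -mxevalM -dX mxevalZ scalerA mulVf // scale1r.
have /polymx_divX GE : mxeval G x = 0.
  have MG0 : mxeval M x *m mxeval G x = 0.
    by rewrite -mxevalM -dX mxevalZ dx0 scale0r.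
  have /mxrank_eq_colP inj := rMx.
  apply/matrixP => i j; have /matrixP/(_ i 0) : col j (mxeval G x) = 0.
    by apply: inj; rewrite colE mulmxA MG0 mul0mx.
  by rewrite !mxE.
have Xx0 : 'X - x%:P != 0 by rewrite polyXsubC_eq0.
have dE : d = ('X - x%:P) * (d %/ ('X - x%:P)).
  by rewrite mulrC divpK // dvdp_XsubCl rootE dx0.
apply: (IH (d %/ ('X - x%:P)) (map_mx (fun p => p %/ ('X - x%:P)) G)).
- by apply: contraNneq d0 => d1; rewrite dE d1 mulr0.
- apply: (scale_polymxI Xx0); rewrite scalerA -dE dX.
  by rewrite {1}GE scalemxAr.
rewrite size_divp // size_XsubC; move: d0 le_l; rewrite -size_poly_gt0.
by case: (size d) => // e _; rewrite !ltnS /= subn1.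
Qed.

End MinimalBases.

(** * Bezoutian matrices *)

Section Kronecker.
Variables (R : comNzRingType) (k : nat).

Lemma big_mxtens (n : nat) (f : 'I_(k * n) -> R) :
  \sum_j f j = \sum_(i < k) \sum_(p < n) f (mxtens_index (i, p)).
Proof.
rewrite pair_bigA /= (reindex (@mxtens_index k n)) /=.
  by apply: eq_bigr => -[i p] _.
by exists (@mxtens_unindex k n) => j _; [exact: mxtens_indexK | exact: mxtens_unindexK].
Qed.

Lemma kron_rowE (n : nat) (u : 'rV[R]_k) i j p :
  kron_row n u p (mxtens_index (i, j)) = u 0 i * (p == j)%:R.
Proof.
rewrite castmxE cast_ord_id mxE mxtens_indexK mxE; congr (u _ _ * _); first exact: ord1.
by congr (_ == _)%:R; apply/val_inj; rewrite /= modn_small // ltn_ord.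
Qed.

Lemma kron_colE (n : nat) (u : 'cV[R]_k) i j p :
  kron_col n u (mxtens_index (i, j)) p = u i 0 * (j == p)%:R.
Proof.
rewrite castmxE cast_ord_id mxE mxtens_indexK mxE; congr (u _ _ * _); first exact: ord1.
by congr (_ == _)%:R; apply/val_inj; rewrite /= modn_small // ltn_ord.
Qed.

Lemma mul_kron_row (n s : nat) (u : 'rV[R]_k) (A : 'M[R]_(k * n, s)) p j :
  (kron_row n u *m A) p j = \sum_i u 0 i * A (mxtens_index (i, p)) j.
Proof.
rewrite mxE big_mxtens; apply: eq_bigr => i _.
rewrite (bigD1 p) //= kron_rowE eqxx mulr1 big1 ?addr0 // => q qp.
by rewrite kron_rowE eq_sym (negPf qp) mulr0 mul0r.
Qed.

Lemma mul_kron_col (m n : nat) (u : 'cV[R]_k) (A : 'M[R]_(m, k * n)) i q :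
  (A *m kron_col n u) i q = \sum_j A i (mxtens_index (j, q)) * u j 0.
Proof.
rewrite mxE big_mxtens; apply: eq_bigr => j _.
rewrite (bigD1 q) //= kron_colE eqxx mulr1 big1 ?addr0 // => p pq.
by rewrite kron_colE (negPf pq) mulr0 mulr0.
Qed.

End Kronecker.

(** * The block Bezoutian of a matrix polynomial and a scalar polynomial *)

Section Bezoutian.
Variable F : closedFieldType.
Implicit Types (u w : {poly F}) (x y : F).

Lemma drop_polyS j (p : {poly F}) : drop_poly j p = 'X * drop_poly j.+1 p + (p`_j)%:P.
Proof.
apply/polyP => i; rewrite coefD coefXM !coef_drop_poly coefC.
by case: i => [|i] /=; rewrite ?add0r // addr0 addSnnS.
Qed.

(* The coefficient of x^(j-1) in (p(y) u(x) - u(y) p(x)) / (x - y), as a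
   polynomial in y. *)
Definition bezout_coef j (p : {poly F}) u := p * drop_poly j u - u * drop_poly j p.

(** Divided difference of [p]: the sum telescopes by [drop_polyS], and the size bound makes the last
    term [drop_poly k p] constant. *)
Lemma drop_poly_telescope k (p : {poly F}) x y : (size p <= k.+1)%N ->
  (x - y) * (\sum_(a < k) x ^+ a * (drop_poly a.+1 p).[y]) = p.[x] - p.[y].
Proof.
move=> sp; rewrite mulr_sumr.
have -> : \sum_(a < k) (x - y) * (x ^+ a * (drop_poly a.+1 p).[y]) =
   \sum_(a < k) (x ^+ a.+1 * (drop_poly a.+1 p).[y] - x ^+ a * (drop_poly a p).[y])
   + \sum_(a < k) p`_a * x ^+ a.
  rewrite -big_split; apply: eq_bigr => a _ /=.
  by rewrite [drop_poly a p]drop_polyS hornerD hornerM hornerX hornerC exprS; ring.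
rewrite -(big_mkord xpredT (fun a => x ^+ a.+1 * (drop_poly a.+1 p).[y] -
  x ^+ a * (drop_poly a p).[y])) telescope_sumr //.
rewrite expr0 mul1r drop_poly0l (horner_coef_wide x sp) big_ord_recr /=.
have -> : drop_poly k p = (p`_k)%:P.
  rewrite drop_polyS (_ : drop_poly k.+1 p = 0) ?mulr0 ?add0r //.
  by apply/eqP; rewrite -size_poly_eq0 size_drop_poly; lia.
by rewrite hornerC; ring.
Qed.

Lemma bezout_coef_telescope k (p : {poly F}) u x y :
  (size p <= k.+1)%N -> (size u <= k.+1)%N ->
  (x - y) * (\sum_(a < k) x ^+ a * (bezout_coef a.+1 p u).[y]) =
  p.[y] * u.[x] - u.[y] * p.[x].
Proof.
move=> sp su.
transitivity (p.[y] * ((x - y) * (\sum_(a < k) x ^+ a * (drop_poly a.+1 u).[y]))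
  - u.[y] * ((x - y) * (\sum_(a < k) x ^+ a * (drop_poly a.+1 p).[y]))).
  rewrite mulrCA [u.[y] * _]mulrCA -mulrBr; congr (_ * _).
  rewrite !mulr_sumr -sumrB; apply: eq_bigr => a _.
  by rewrite /bezout_coef hornerD hornerN !hornerM; ring.
by rewrite !drop_poly_telescope //; ring.
Qed.

(** When [p] and [u] are split at degree [j], the products of the two high parts cancel. Each
    remaining product pairs a part of size at most [j] with one of size at most [k + 1 - j]. *)
Lemma size_bezout_coef k j (p : {poly F}) u : (0 < j)%N ->
  (size p <= k.+1)%N -> (size u <= k.+1)%N -> (size (bezout_coef j p u) <= k)%N.
Proof.
move=> j0 sp su.
have -> : bezout_coef j p u = take_poly j p * drop_poly j u - take_poly j u * drop_poly j p.
  rewrite /bezout_coef -{1}(poly_take_drop j p) -{2}(poly_take_drop j u); ring.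
have aux (p' u' : {poly F}) : (size p' <= k.+1)%N -> (size u' <= k.+1)%N ->
    (size (take_poly j p' * drop_poly j u')%R <= k)%N.
  move=> sp' su'; have [->|d0] := eqVneq (drop_poly j u') 0.
    by rewrite mulr0 size_poly0.
  apply: (leq_trans (size_polyMleq _ _)).
  move: d0; rewrite -size_poly_gt0 size_drop_poly.
  have := size_take_poly j p'; lia.
by rewrite (leq_trans (size_polyD _ _)) // geq_max size_polyN !aux.
Qed.

(** Block [(i, j)] holds the coefficient of [y^(k-1-i) x^(k-1-j)] in the Bezout form, in the
    decreasing order of [Vvec]. *)
Definition bezout_mx k m n (P : 'M[{poly F}]_(m, n)) u : 'M[F]_(k * m, k * n) :=
  \matrix_(I, J) (bezout_coef (k - (@mxtens_unindex _ _ J).1)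
    (P (@mxtens_unindex _ _ I).2 (@mxtens_unindex _ _ J).2) u
    )`_(k - (@mxtens_unindex _ _ I).1.+1).

Lemma bezout_mxE k m n (P : 'M[{poly F}]_(m, n)) u i p j q :
  bezout_mx k P u (mxtens_index (i, p)) (mxtens_index (j, q)) =
  (bezout_coef (k - j) (P p q) u)`_(k - i.+1).
Proof. by rewrite mxE !mxtens_indexK. Qed.

Lemma horner_rev_ord k (p : {poly F}) x : (size p <= k)%N ->
  \sum_(i < k) x ^+ (k - i.+1) * p`_(k - i.+1) = p.[x].
Proof.
move=> sp; rewrite (horner_coef_wide x sp) [RHS](reindex_inj rev_ord_inj) /=.
by apply: eq_bigr => i _; rewrite mulrC.
Qed.

Section Fixed.
Variables (k m n : nat) (P : 'M[{poly F}]_(m, n)).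
Hypothesis gradeP : has_grade k P.

Lemma kron_row_bezout_mx u y p j q : (size u <= k.+1)%N ->
  (kron_row m (Vvec k y)^T *m bezout_mx k P u) p (mxtens_index (j, q)) =
  (bezout_coef (k - j) (P p q) u).[y].
Proof.
move=> su; rewrite mul_kron_row -(@horner_rev_ord k); last first.
  by apply: size_bezout_coef => //; have := ltn_ord j; lia.
by apply: eq_bigr => i _; rewrite bezout_mxE !mxE.
Qed.

Lemma bezout_mx_biform u x y : (size u <= k.+1)%N ->
  (x - y) *: (kron_row m (Vvec k y)^T *m bezout_mx k P u *m kron_col n (Vvec k x)) =
  u.[x] *: mxeval P y - u.[y] *: mxeval P x.
Proof.
move=> su; apply/matrixP => p q; rewrite !mxE.
have := @mul_kron_col F k m n (Vvec k x) (kron_row m (Vvec k y)^T *m bezout_mx k P u) p q.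
rewrite mxE => ->.
have -> : \sum_j (kron_row m (Vvec k y)^T *m bezout_mx k P u) p (mxtens_index (j, q)) *
    Vvec k x j 0 = \sum_(a < k) x ^+ a * (bezout_coef a.+1 (P p q) u).[y].
  rewrite [RHS](reindex_inj rev_ord_inj) /=.
  apply: eq_bigr => j _; rewrite kron_row_bezout_mx // !mxE mulrC.
  by congr (_ * (bezout_coef _ _ _).[_]); have := ltn_ord j; lia.
by rewrite bezout_coef_telescope // [u.[x] * _]mulrC.
Qed.

End Fixed.

(** For fixed [y] the factor [x - y] cancels in the ring of polynomials in [x]; coefficients are
    then compared first in [x], afterwards in [y]. *)
Lemma biform_inj k m n (B : 'M[F]_(k * m, k * n)) :
  (forall x y, (x - y) *:
    (kron_row m (Vvec k y)^T *m B *m kron_col n (Vvec k x)) = 0) -> B = 0.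
Proof.
move=> B0; apply/matrixP => I J.
case: (mxtens_indexP I) => i p; case: (mxtens_indexP J) => j q.
pose f (j : 'I_k) (y : F) :=
  \sum_(i < k) y ^+ (k - i.+1) * B (mxtens_index (i, p)) (mxtens_index (j, q)).
have f0 j' y : f j' y = 0.
  (* [Vvec] lists powers in decreasing order, so degree [a] belongs to index [k - 1 - a]; [insub]
     makes this an ordinal, and its default [0] is never reached for [a < k]. *)
  pose g := \poly_(a < k) (if insub (k - a.+1)%N is Some l then f l y else 0).
  have gE (x : F) : g.[x] = \sum_(j < k) f j y * x ^+ (k - j.+1).
    rewrite horner_poly (reindex_inj rev_ord_inj) /=; apply: eq_bigr => l _.
    have e : (k - (k - l.+1).+1 = l)%N by have := ltn_ord l; lia.
    by rewrite e valK.
  have : ('X - y%:P) * g = 0.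
    apply: eq_horner => x; rewrite hornerM hornerXsubC horner0 gE.
    have /matrixP/(_ p q) := B0 x y; rewrite [LHS]mxE mul_kron_col [RHS]mxE => e.
    rewrite -[RHS]e.
    congr (_ * _); apply: eq_bigr => l _; rewrite [Vvec _ _ _ _]mxE mul_kron_row.
    by congr (_ * _); apply: eq_bigr => i' _; rewrite !mxE.
  move/eqP; rewrite mulf_eq0 polyXsubC_eq0 /= => /eqP.
  move/(congr1 (fun h : {poly F} => h`_(k - j'.+1))).
  rewrite coef_poly coef0; have lj := ltn_ord j'.
  have -> : (k - j'.+1 < k)%N by lia.
  have e : (k - (k - j'.+1).+1 = j')%N by lia.
  by rewrite e valK.
pose g := \poly_(a < k) (if insub (k - a.+1)%N is Some l then
    B (mxtens_index (l, p)) (mxtens_index (j, q)) else 0).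
have : g = 0.
  apply: eq_horner => y; rewrite horner0 -(f0 j y) /f.
  rewrite horner_poly (reindex_inj rev_ord_inj) /=; apply: eq_bigr => l _.
  have e : (k - (k - l.+1).+1 = l)%N by have := ltn_ord l; lia.
  by rewrite e valK mulrC.
move/(congr1 (fun h : {poly F} => h`_(k - i.+1))).
rewrite coef_poly coef0 mxE; have li := ltn_ord i.
have -> : (k - i.+1 < k)%N by lia.
have e : (k - (k - i.+1).+1 = i)%N by lia.
by rewrite e valK.
Qed.

Lemma map_mx_kron_row (R S : comNzRingType) (f : {rmorphism R -> S})
    k m (u : 'rV[R]_k) :
  map_mx f (kron_row m u) = kron_row m (map_mx f u).
Proof.
apply/matrixP => i J; case: (mxtens_indexP J) => j q.
by rewrite mxE !kron_rowE mxE rmorphM rmorph_nat.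
Qed.

Lemma map_mx_kron_col (R S : comNzRingType) (f : {rmorphism R -> S})
    k m (u : 'cV[R]_k) :
  map_mx f (kron_col m u) = kron_col m (map_mx f u).
Proof.
apply/matrixP => J i; case: (mxtens_indexP J) => j q.
by rewrite mxE !kron_colE mxE rmorphM rmorph_nat.
Qed.

Lemma map_mx_Vvec (R S : comNzRingType) (f : {rmorphism R -> S}) k (x : R) :
  map_mx f (Vvec k x) = Vvec k (f x).
Proof. by apply/matrixP => i j; rewrite !mxE rmorphXn. Qed.

End Bezoutian.

(** * The values of the pencil as Bezoutians, and the one-sided factorizations at a root *)

Section DLPencil.
Variable F : closedFieldType.
Implicit Types (u w : {poly F}) (x y : F).

Definition coefvec k w : 'cV[F]_k := \col_(i < k) w`_(k - i.+1).

Lemma drop_poly_mulXsubC a w x :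
  drop_poly a.+1 (('X - x%:P) * w) = ('X - x%:P) * drop_poly a.+1 w + (w`_a)%:P.
Proof.
have -> : drop_poly a.+1 (('X - x%:P) * w) = drop_poly a w - x%:P * drop_poly a.+1 w.
  apply/polyP => i; rewrite mulrBl !(coefB, coefCM, coef_drop_poly).
  by rewrite addnS coefXM.
by rewrite (drop_polyS a w); ring.
Qed.

Section Fixed.
Variables (k m n : nat) (P : 'M[{poly F}]_(m, n)).
Hypothesis gradeP : has_grade k P.

(** With [y] set to the root [x] of [u], the Bezout form loses its second term and becomes [P(x)]
    times the cofactor [w]. *)
Lemma kron_row_bezout_mx_root x w : (size (('X - x%:P) * w)%R <= k.+1)%N ->
  kron_row m (Vvec k x)^T *m bezout_mx k P (('X - x%:P) * w) =
  mxeval P x *m kron_row n (coefvec k w)^T.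
Proof.
move=> su; apply/matrixP => p J; case: (mxtens_indexP J) => j q.
rewrite kron_row_bezout_mx // /bezout_coef hornerD hornerN !hornerM hornerXsubC subrr !mul0r subr0.
have lj := ltn_ord j; have -> : (k - j = (k - j.+1).+1)%N by lia.
rewrite drop_poly_mulXsubC hornerD hornerM hornerXsubC subrr mul0r add0r hornerC.
rewrite mxE (bigD1 q) //= kron_rowE !mxE eqxx mulr1 big1 ?addr0 // => l lq.
by rewrite kron_rowE (negPf lq) !mulr0.
Qed.

(** Entrywise, the product lists the coefficients of the polynomial [s] below; cancelling
    ['X - x%:P] in the telescoped Bezout identity shows that [s] is the entry of [P(x)] times
    [w]. *)
Lemma bezout_mx_kron_col_root x w : (size (('X - x%:P) * w)%R <= k.+1)%N ->
  bezout_mx k P (('X - x%:P) * w) *m kron_col n (Vvec k x) =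
  kron_col m (coefvec k w) *m mxeval P x.
Proof.
move=> su; apply/matrixP => I q; case: (mxtens_indexP I) => i p.
have -> : (kron_col m (coefvec k w) *m mxeval P x) (mxtens_index (i, p)) q =
    w`_(k - i.+1) * (P p q).[x].
  rewrite mxE (bigD1 p) //= kron_colE !mxE eqxx mulr1 big1 ?addr0 // => l lp.
  by rewrite kron_colE eq_sym (negPf lp) mulr0 mul0r.
rewrite mul_kron_col.
pose s := \sum_(a < k) (x ^+ a)%:P * bezout_coef a.+1 (P p q) (('X - x%:P) * w).
have sE : s = ((P p q).[x])%:P * w.
  apply: (@mulfI _ ('X - x%:P)); first by rewrite polyXsubC_eq0.
  apply: eq_horner => y.
  have := @bezout_coef_telescope F k (P p q) (('X - x%:P) * w) x y (gradeP p q) su.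
  rewrite !hornerM !hornerXsubC hornerC subrr mul0r mulr0 add0r /s horner_sum.
  have -> : \sum_(a < k) ((x ^+ a)%:P * bezout_coef a.+1 (P p q) (('X - x%:P) * w)).[y] =
     \sum_(a < k) x ^+ a * (bezout_coef a.+1 (P p q) (('X - x%:P) * w)).[y].
    by apply: eq_bigr => a _; rewrite hornerM hornerC.
  by move=> e; rewrite -(opprB x y) mulNr e; ring.
transitivity (s`_(k - i.+1)); last by rewrite sE coefCM mulrC.
rewrite /s coef_sum [RHS](reindex_inj rev_ord_inj) /=.
apply: eq_bigr => j _; rewrite bezout_mxE !mxE coefCM mulrC.
by congr (_ * (bezout_coef _ _ _)`_ _); have := ltn_ord j; lia.
Qed.

End Fixed.

Lemma bezout_mxD k m n (P : 'M[{poly F}]_(m, n)) u w (c : F) :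
  bezout_mx k P (u + c *: w) = bezout_mx k P u + c *: bezout_mx k P w.
Proof.
apply/matrixP => i j; rewrite !mxE /bezout_coef drop_polyD drop_polyZ.
rewrite -coefZ -coefD; congr (_`_ _); rewrite scalerBr mulrDr mulrDl opprD.
by rewrite -scalerAr -scalerAl addrACA.
Qed.

Definition eval3 x y z : {rmorphism poly3 F -> F} :=
  horner_eval x \o (horner_eval y%:P \o horner_eval z%:P%:P).

Lemma eval3_psubst x y z (s : poly3 F) (p : {poly F}) :
  eval3 x y z (psubst s p) = p.[eval3 x y z s].
Proof.
rewrite /psubst -horner_map; congr (_.[_]); apply/polyP => i.
by rewrite coef_map coef_map_id0 /= ?/const3 ?polyC0 // /horner_eval !hornerC.
Qed.

Lemma eval3_mxsubst x y z (s : poly3 F) m n (P : 'M[{poly F}]_(m, n)) :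
  map_mx (eval3 x y z) (mxsubst s P) = mxeval P (eval3 x y z s).
Proof. by apply/matrixP => i j; rewrite !mxE eval3_psubst. Qed.

(** At scalar values of [x], [y], [z] the defining identity of the pencil is the Bezout identity for
    [('X - z%:P) * v]; [biform_inj] then identifies the matrices. *)
Lemma isDL_bezout_mx k m n (P : 'M[{poly F}]_(m, n)) (v : {poly F}) L z :
  (0 < k)%N -> has_grade k P -> (size v <= k)%N -> isDL P v L ->
  mxeval L z = bezout_mx k P (('X - z%:P) * v).
Proof.
move=> k0 gradeP sv [_ DL]; apply/eqP; rewrite -subr_eq0; apply/eqP.
apply: biform_inj => x y.
have su : (size (('X - z%:P) * v)%R <= k.+1)%N.
  by apply: leq_trans (size_polyMleq _ _) _; rewrite size_XsubC addSn add1n ltnS.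
rewrite mulmxBr mulmxBl scalerBr bezout_mx_biform // !hornerM !hornerXsubC.
have := congr1 (map_mx (eval3 x y z)) DL.
have eX : eval3 x y z (Xx F) = x by rewrite /= /horner_eval !hornerC hornerX.
have eY : eval3 x y z (Xy F) = y by rewrite /= /horner_eval hornerC hornerX hornerC.
have eZ : eval3 x y z (Xz F) = z by rewrite /= /horner_eval hornerX !hornerC.
rewrite map_mxZ map_mxB !map_mxZ !map_mxM map_mx_kron_row map_mx_kron_col.
rewrite -map_trmx !map_mx_Vvec !eval3_mxsubst !rmorphM !rmorphB.
rewrite !eval3_psubst eX eY eZ => ->; exact: subrr.
Qed.

End DLPencil.

(** * Lower rank bound *)

Section RankBounds.
Variable F : closedFieldType.
Implicit Types (u w : {poly F}) (x y : F).
Variables (k m n : nat) (P : 'M[{poly F}]_(m, n)).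
Hypothesis gradeP : has_grade k P.

(* [C_a]: the block of [C] paired with the monomial [x^a]. *)
Definition block s (C : 'M[F]_(k * n, s)) (a : nat) : 'M[F]_(n, s) :=
  \matrix_(q, j) (if insub (k - a.+1)%N is Some i then C (mxtens_index (i, q)) j
                  else 0).

Lemma blockE s (C : 'M[F]_(k * n, s)) (i : 'I_k) q j :
  block C (k - i.+1) q j = C (mxtens_index (i, q)) j.
Proof.
rewrite mxE (_ : (k - (k - i.+1).+1)%N = i) ?valK //.
have := ltn_ord i; lia.
Qed.

Lemma block_eq0 s (C : 'M[F]_(k * n, s)) :
  (forall a, (a < k)%N -> block C a = 0) -> C = 0.
Proof.
move=> C0; apply/matrixP => I j; case: (mxtens_indexP I) => i q.
by rewrite -blockE C0 ?mxE //; have := ltn_ord i; lia.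
Qed.

Lemma blockM s t (C : 'M[F]_(k * n, s)) (N : 'M_(s, t)) a :
  block (C *m N) a = block C a *m N.
Proof.
apply/matrixP => q j; rewrite !mxE; case eqi: (insub _) => [i|].
  by rewrite mxE; apply: eq_bigr => l _; rewrite mxE eqi.
by rewrite big1 // => l _; rewrite mxE eqi mul0r.
Qed.

(** The rows of [B C = 0], read as coefficients in [y], annihilate the combination of the
    [bezout_coef] with the blocks of [C]; its two terms are then separated. The sum multiplied by
    [P] is the polynomial encoding [h] of [C]. *)
Lemma bezout_mx_kernel s (C : 'M[F]_(k * n, s)) u : (size u <= k.+1)%N ->
  bezout_mx k P u *m C = 0 ->
  P *m (\sum_(a < k) drop_poly a.+1 u *: mxconst (block C a)) =
  u *: (\sum_(a < k) map_mx (drop_poly a.+1) P *m mxconst (block C a)).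
Proof.
move=> su BC0.
have : \sum_(a < k) (\matrix_(p, q) bezout_coef a.+1 (P p q) u) *m mxconst (block C a) = 0.
  apply/eq_mxeval => y; apply/matrixP => p j.
  have := congr1 (fun A => (kron_row m (Vvec k y)^T *m A) p j) BC0.
  rewrite mulmx0 mulmxA mxE big_mxtens !mxE horner0 => e; rewrite -[RHS]e.
  rewrite summxE horner_sum [LHS](reindex_inj rev_ord_inj) /=.
  apply: eq_bigr => i _; rewrite mxE horner_sum; apply: eq_bigr => q _.
  rewrite kron_row_bezout_mx // hornerM mxE mxE blockE hornerC.
  by congr ((bezout_coef _ _ _).[_] * _); have := ltn_ord i; lia.
move=> e; apply/eqP; rewrite -subr_eq0 -[X in _ == X]e; apply/eqP.
rewrite mulmx_sumr scaler_sumr -sumrB; apply: eq_bigr => a _.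
apply/matrixP => p j; rewrite -scalemxAr !mxE !mulr_sumr -sumrB.
by apply: eq_bigr => q _; rewrite !mxE /bezout_coef; ring.
Qed.

Lemma size_sum_drop s (C : 'M[F]_(k * n, s)) u i j :
  (size ((\sum_(a < k) drop_poly a.+1 u *: mxconst (block C a))%R i j)
    <= (size u).-1)%N.
Proof.
rewrite summxE; apply: (leq_trans (size_sum _ _ _)); apply/bigmax_leqP => a _.
rewrite mxE [mxconst _ _ _]mxE mulrC mul_polyC.
by apply: (leq_trans (size_scale_leq _ _)); rewrite size_drop_poly; lia.
Qed.

(** The system is triangular: in degree [deg u - a - 1], summand [a] contributes [lead_coef u] times
    block [a], later summands have smaller degree, and earlier blocks vanish by induction. *)
Lemma block_low_eq0 s (C : 'M[F]_(k * n, s)) u : (size u <= k.+1)%N ->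
  \sum_(a < k) drop_poly a.+1 u *: mxconst (block C a) = 0 ->
  forall a, (a < (size u).-1)%N -> block C a = 0.
Proof.
move=> su h0 a; have [l] := ubnP a; elim: l a => // l IH a al ad.
have ak : (a < k)%N by lia.
apply/matrixP => q j.
have := congr1 (fun A : 'M[{poly F}]_(n, s) => (A q j)`_((size u).-1 - a.+1)) h0.
rewrite /= summxE coef_sum [in RHS]mxE coef0 (bigD1 (Ordinal ak)) //= big1 => [|b ba].
  rewrite addr0 mxE [mxconst _ _ _]mxE coefMC coef_drop_poly subnK // -lead_coefE.
  move=> /eqP; rewrite mulf_eq0 lead_coef_eq0 => /orP[/eqP u0|/eqP->]; last first.
    by rewrite mxE.
  by move: ad; rewrite u0 size_poly0.
rewrite mxE [mxconst _ _ _]mxE coefMC coef_drop_poly.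
case: (ltngtP b a) => [lt_ba|lt_ab|e]; last by case/eqP: ba; apply/val_inj.
  rewrite IH ?mxE ?mulr0 //; first exact: leq_trans lt_ba _.
  exact: ltn_trans lt_ba ad.
rewrite nth_default ?mul0r //; move: ad lt_ab; case: (size _) => [|d] /=; lia.
Qed.

(** The encoding of [C] is now zero, so [u] cancels in [bezout_mx_kernel]. What remains says, in
    reversed order of coefficients, that the low coefficients of the product with [mxrev k P]
    vanish. *)
Lemma bezout_mx_kernel_high s (C : 'M[F]_(k * n, s)) u : (size u <= k.+1)%N ->
  u != 0 -> bezout_mx k P u *m C = 0 ->
  (forall a, (a < (size u).-1)%N -> block C a = 0) ->
  exists W, mxrev k P *m
      (\sum_(i < k - (size u).-1) 'X^i *: mxconst (block C ((size u).-1 + i))) =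
    'X^(k - (size u).-1) *: W.
Proof.
move=> su u0 BC0 C0; set d := (size u).-1 in C0 *; set e := (k - d)%N.
have dk : (d <= k)%N by rewrite /d; lia.
have := bezout_mx_kernel su BC0; rewrite big1 ?mulmx0 => [h|a _]; last first.
  case: (ltnP a d) => ad.
    apply/matrixP => i j; rewrite mxE [mxconst _ _ _]mxE C0 // !mxE.
    by rewrite polyC0 mulr0.
  rewrite (_ : drop_poly a.+1 u = 0) ?scale0r //.
  by apply/eqP; rewrite -size_poly_eq0 size_drop_poly; move: ad; rewrite /d; lia.
have {}h : \sum_(a < k) map_mx (drop_poly a.+1) P *m mxconst (block C a) = 0.
  by apply: (scale_polymxI u0); rewrite -h scaler0.
set R := _ *m _; exists (map_mx (drop_poly e) R).
apply/matrixP => p j; rewrite [RHS]mxE [map_mx _ _ _ _]mxE.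
rewrite -{1}(poly_take_drop e (R p j)) [LHS]addrC mulrC.
suff -> : take_poly e (R p j) = 0 by rewrite addr0.
apply/polyP => l; rewrite coef_take_poly coef0; case: ifP => // le.
have := congr1 (fun A : 'M[{poly F}]_(m, s) => (A p j)`_(e - l.+1)) h.
rewrite /= summxE coef_sum [in RHS]mxE coef0 => hl.
(* Coefficient [l] of the reversed product matches coefficient [e - 1 - l] of the sum in [h]; terms
   with [i > l] involve coefficients of [P] beyond its grade. *)
transitivity (\sum_(i < e) \sum_q (P p q)`_(k - l + i) * block C (d + i) q j).
  rewrite /R mulmx_sumr summxE coef_sum; apply: eq_bigr => i _.
  rewrite -scalemxAr mxE coefXnM mxE coef_sum.
  case: ltnP => li.
    rewrite big1 // => q _; rewrite nth_default ?mul0r //.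
    by apply: leq_trans (gradeP _ _) _; lia.
  apply: eq_bigr => q _; rewrite !mxE coefMC coef_poly.
  by rewrite ifT; [congr (_`_ _ * _); lia | lia].
rewrite -[RHS]hl.
rewrite -(big_mkord xpredT (fun i =>
  \sum_q (P p q)`_(k - l + i) * block C (d + i) q j)).
rewrite -(big_mkord xpredT (fun a =>
  ((map_mx (drop_poly a.+1) P *m mxconst (block C a)) p j)`_(e - l.+1))).
rewrite [RHS](big_cat_nat _ dk) //= [X in _ = X + _]big_nat_cond.
rewrite [X in _ = X + _]big1 ?add0r; last first.
  move=> a /andP[/andP[_ ad] _]; rewrite C0 // mxE coef_sum big1 // => q _.
  by rewrite !mxE polyC0 mulr0 coef0.
rewrite -{2}[d]add0n big_addn -/e; apply: eq_bigr => i _.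
rewrite mxE coef_sum addnC; apply: eq_bigr => q _.
rewrite [mxconst _ _ _]mxE coefMC [map_mx _ _ _ _]mxE coef_drop_poly.
rewrite [(d + i)%N]addnC; congr (_`_ _ * _).
by move: le dk; rewrite /e; clearbody d; lia.
Qed.

Lemma block_high_eq0 s (C : 'M[F]_(k * n, s)) d :
  \sum_(i < k - d) 'X^i *: mxconst (block C (d + i)) = 0 ->
  forall a, (d <= a < k)%N -> block C a = 0.
Proof.
move=> h0 a /andP[da ak]; apply/matrixP => q j.
have := congr1 (fun A : 'M[{poly F}]_(n, s) => (A q j)`_(a - d)) h0.
have adk : (a - d < k - d)%N by lia.
rewrite /= summxE coef_sum [in RHS]mxE coef0 (bigD1 (Ordinal adk)) //= big1 => [|b ba].
  by rewrite addr0 mxE [mxconst _ _ _]mxE coefMC coefXn eqxx mul1r subnKC // => ->;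
    rewrite mxE.
rewrite mxE [mxconst _ _ _]mxE coefMC coefXn (_ : (_ == _) = false) ?mul0r //.
by apply: contraNF ba => /eqP e; apply/eqP/val_inj.
Qed.

(** The columns of [C] span [ker B] and are cut down twice: [N1] kills the low blocks at the cost of
    the nullities of [P] at the roots of [u], then [N2] kills the rest at the cost of the nullity of
    the reversal at [0], once per missing degree. Since [C N1 N2 = 0], Sylvester's inequality bounds
    the rank of [C]. *)
Lemma rank_bezout_mx_ge (c : F) (zs : seq F) : c != 0 -> (size zs <= k)%N ->
  (k * n <= \rank (bezout_mx k P (c *: \prod_(z <- zs) ('X - z%:P))%R)
    + (\sum_(z <- zs) (n - \rank (mxeval P z))
       + (k - size zs) * (n - \rank (mxeval (mxrev k P) 0))))%N.
Proof.
move=> c0 szs; set u := c *: _; set B := bezout_mx k P u.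
have size_u : size u = (size zs).+1 by rewrite size_scale // size_prod_XsubC.
have u0 : u != 0 by rewrite -size_poly_eq0 size_u.
have su : (size u <= k.+1)%N by rewrite size_u.
pose C := cokermx B.
have BC0 : B *m C = 0 by exact: mulmx_coker.
have [||N1 [HN1 rN1]] := @kernel_mod_prod_XsubC F m n _ P zs
   (\sum_(a < k) drop_poly a.+1 u *: mxconst (block C a))
   (c%:P *: \sum_(a < k) map_mx (drop_poly a.+1) P *m mxconst (block C a)).
- by move=> i j; apply: leq_trans (size_sum_drop _ _ _ _) _; rewrite size_u.
- by rewrite bezout_mx_kernel // scalerA mulrC mul_polyC.
have BC10 : B *m (C *m N1) = 0 by rewrite mulmxA BC0 mul0mx.
have C1_low : forall a, (a < (size u).-1)%N -> block (C *m N1) a = 0.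
  apply: block_low_eq0 => //; rewrite -[RHS]HN1 mulmx_suml.
  by apply: eq_bigr => a _; rewrite blockM mxconstM scalemxAl.
have [W HW] := bezout_mx_kernel_high su u0 BC10 C1_low.
rewrite size_u /= in HW C1_low.
(* Here the point [0] is repeated, its product of linear factors being ['X^(k - size zs)]. *)
have [||N2 [HN2 rN2]] := @kernel_mod_prod_XsubC F m n _ (mxrev k P)
   (nseq (k - size zs) 0)
   (\sum_(i < k - size zs) 'X^i *: mxconst (block (C *m N1) (size zs + i))) W.
- move=> i j; rewrite size_nseq summxE; apply: (leq_trans (size_sum _ _ _)).
  apply/bigmax_leqP => a _; rewrite mxE [mxconst _ _ _]mxE mulrC mul_polyC.
  by apply: (leq_trans (size_scale_leq _ _)); rewrite size_polyXn.
- by rewrite big_nseq -Monoid.iteropE polyC0 subr0 HW; congr (_ *: _).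
have CNN0 : C *m N1 *m N2 = 0.
  apply: block_eq0 => a ak; rewrite blockM.
  case: (ltnP a (size zs)) => az; first by rewrite C1_low // mul0mx.
  rewrite -blockM; apply: (@block_high_eq0 _ _ (size zs)); last by rewrite az.
  rewrite -[RHS]HN2 mulmx_suml.
  by apply: eq_bigr => i _; rewrite blockM mxconstM scalemxAl.
have r1 := mxrank_mul_min C N1; have r2 := mxrank_mul_min (C *m N1) N2.
rewrite CNN0 mxrank0 in r2.
have rC : \rank C = (k * n - \rank B)%N by exact: mxrank_coker.
rewrite big_nseq iter_addn_0 [X in (_ <= _ + X)%N]mulnC in rN2.
have arith (kn rB rc r3 r4 r5 s1 s2 : nat) : rc = (kn - rB)%N ->
    (rc + r3 - kn <= r5)%N -> (r5 + r4 - kn <= 0)%N ->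
    (kn <= r3 + s1)%N -> (kn <= r4 + s2)%N -> (kn <= rB + (s1 + s2))%N by lia.
exact: arith rC r1 r2 rN1 rN2.
Qed.

End RankBounds.

(** * Upper rank bound *)

Section UpperBound.
Variable F : closedFieldType.
Implicit Types (u w : {poly F}) (x y : F).

Lemma exists_uniq_seq l : exists zs : seq F, uniq zs /\ size zs = l.
Proof.
elim: l => [|l [zs [uzs szs]]]; first by exists [::].
have : \prod_(z <- zs) ('X - z%:P) != 0 by exact/monic_neq0/monic_prod_XsubC.
move/closed_nonrootP => [z]; rewrite root_prod_XsubC => nz.
by exists (z :: zs); rewrite /= nz uzs szs.
Qed.

Lemma size_lead_coef u l : (size u <= l.+1)%N -> u`_l != 0 -> size u = l.+1.
Proof.
move=> su ul; apply/eqP; rewrite eqn_leq su /= ltnNge; apply: contraNN ul => le.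
by rewrite nth_default.
Qed.

(** A vector killed by the transpose lists the coefficients of a polynomial of size at most [k] with
    [k] distinct roots. *)
Lemma vandermonde_unit k (zs : seq F) : uniq zs -> size zs = k ->
  (\matrix_(i < k, l < k) (zs`_l) ^+ (k - i.+1)) \in unitmx.
Proof.
move=> uzs szs; rewrite -unitmx_tr -row_full_unit; apply/eqP/mxrank_eq_colP => c Vc0.
pose g := \poly_(a < k) (if insub (k - a.+1)%N is Some l then c l 0 else 0).
have e (l : 'I_k) : (k - (k - l.+1).+1 = l)%N by have := ltn_ord l; lia.
have g0 : g = 0.
  apply/eqP/negPn/negP => g0.
  have : all (root g) zs.
    apply/(all_nthP 0) => i; rewrite szs => ik; rewrite rootE horner_poly.
    have := congr1 (fun A : 'cV[F]_k => A (Ordinal ik) 0) Vc0; rewrite !mxE => Vi.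
    rewrite (reindex_inj rev_ord_inj) /= -[X in _ == X]Vi; apply/eqP.
    by apply: eq_bigr => l _; rewrite e valK !mxE mulrC.
  move/(max_poly_roots g0)/(_ uzs); rewrite szs ltnNge size_poly //.
apply/colP => l; have := congr1 (fun h : {poly F} => h`_(k - l.+1)) g0.
rewrite coef_poly coef0 e valK mxE => <-.
by rewrite ifT //; have := ltn_ord l; lia.
Qed.

(* A double root of [u + s w] is a root of [u w' - u' w], and it determines [s]
   because [w] has simple roots. *)
Lemma simple_roots_perturbation k u : (size u <= k.+1)%N ->
  exists w (d : {poly F}), [/\ (size w <= k.+1)%N, d != 0 & forall s, d.[s] != 0 ->
    exists c zs, [/\ uniq zs, size zs = k &
      u + s *: w = c *: \prod_(z <- zs) ('X - z%:P)]].
Proof.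
move=> su; have [ws [uws sws]] := exists_uniq_seq k.
set w := \prod_(z <- ws) ('X - z%:P).
have sw : size w = k.+1 by rewrite size_prod_XsubC sws.
have wk : w`_k = 1.
  by have /monicP := monic_prod_XsubC ws xpredT id; rewrite lead_coefE -/w sw.
have cop : coprimep w w^`().
  by have := separable_prod_XsubC ws; rewrite uws separable_poly.unlock.
exists w; pose f := u * w^`() - u^`() * w.
(* If [u w' = u' w], then [w], being coprime to [w'], divides [u]. So [u + s w] is a scalar multiple
   of [w] for every [s], and [d = 1] serves. *)
have [f0 | f_nz] := eqVneq f 0.
  exists 1; split; rewrite ?sw ?oner_neq0 // => s _.
  have /dvdpP[q uE] : w %| u.
    rewrite -(Gauss_dvdpl _ cop) (_ : u * w^`() = u^`() * w) ?dvdp_mull //.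
    exact: subr0_eq f0.
  have sq : (size q <= 1)%N.
    have [-> | q0] := eqVneq q 0; first by rewrite size_poly0.
    have := size_Mmonic q0 (monic_prod_XsubC ws xpredT id); rewrite -/w -uE sw => eq_su.
    by move: su; rewrite eq_su addnS /= ; rewrite -add1n leq_add2r.
  exists (q`_0 + s), ws; split=> //.
  by rewrite -/w uE {1}(size1_polyC sq) mul_polyC scalerDl.
have [fs fE] := closed_field_poly_normal f.
(* The root of [e z] is the only [s] for which [z] is a root of [u + s w] or, when [w(z) = 0], of
   its derivative. The further factor of [d] below keeps the degree equal to [k], as [w] is
   monic. *)
pose e z := if w.[z] != 0 then w.[z] *: 'X + u.[z]%:P
  else w^`().[z] *: 'X + u^`().[z]%:P.
exists (('X + (u`_k)%:P) * \prod_(z <- fs) e z); split; rewrite ?sw //.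
  rewrite mulf_neq0 //; first by rewrite -size_poly_eq0 size_XaddC.
  rewrite prodf_seq_neq0; apply/allP => z zfs; apply/implyP => _.
  have aux (a b : F) : a != 0 -> a *: 'X + b%:P != 0.
    apply: contraNneq => /(congr1 (fun h : {poly F} => h`_1)).
    by rewrite coefD coefZ coefX coefC coef0 /= mulr1 addr0 => ->.
  rewrite /e; case: ifPn => [|/negPn wz]; first exact: aux.
  by apply: aux; apply: (Pdiv.ClosedField.coprimepP _ _ cop); rewrite rootE.
move=> s; rewrite hornerM mulf_eq0 negb_or !hornerE => /andP[lead_nz prod_nz].
set p := u + s *: w.
have sp : size p = k.+1.
  apply: size_lead_coef.
    rewrite (leq_trans (size_polyD _ _)) // geq_max su.
    by rewrite (leq_trans (size_scale_leq _ _)) // sw.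
  by rewrite coefD coefZ wk mulr1 addrC.
have [zs pE] := closed_field_poly_normal p.
have p_nz : p != 0 by rewrite -size_poly_eq0 sp.
exists (lead_coef p), zs; split=> //; last first.
  have := congr1 (fun h : {poly F} => size h) pE.
  by rewrite size_scale ?lead_coef_eq0 // size_prod_XsubC sp => -[].
rewrite -separable_prod_XsubC separable_poly.unlock.
apply/Pdiv.ClosedField.coprimepP => x; set g := \prod_(z <- zs) _ in pE *.
move=> /eqP gx; apply/negP => /eqP g'x.
have px : p.[x] = 0 by rewrite pE hornerZ gx mulr0.
have p'x : p^`().[x] = 0 by rewrite pE derivZ hornerZ g'x mulr0.
have p'E : p^`() = u^`() + s *: w^`() by rewrite derivD derivZ.
have : root f x.
  have -> : f = p * w^`() - p^`() * w.
    by rewrite p'E /p /f -!mul_polyC; ring.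
  by rewrite rootE hornerD hornerN !hornerM px p'x !mul0r subrr.
rewrite fE rootZ ?lead_coef_eq0 // root_prod_XsubC => xfs.
move: prod_nz; rewrite horner_prod prodf_seq_neq0 => /allP/(_ x xfs)/=.
rewrite /e; case: ifP => _; rewrite hornerD hornerZ hornerX hornerC => /eqP; apply.
  by rewrite -[RHS]px hornerD hornerZ mulrC addrC.
by rewrite -[RHS]p'x p'E hornerD hornerZ mulrC addrC.
Qed.

Section Fixed.
Variables (k m n : nat) (P : 'M[{poly F}]_(m, n)).
Hypothesis gradeP : has_grade k P.

(** Inverting the Vandermonde matrix of the roots splits the identity, hence the Bezoutian, into [k]
    summands, each of which factors through the value of [P] at one root. *)
Lemma rank_bezout_mx_simple_roots (c : F) zs : uniq zs -> size zs = k ->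
  (\rank (bezout_mx k P (c *: \prod_(z <- zs) ('X - z%:P))%R) <= k * \rank (mxfrac P))%N.
Proof.
move=> uzs szs; set u := c *: _; set B := bezout_mx k P u.
have su : (size u <= k.+1)%N.
  by rewrite (leq_trans (size_scale_leq _ _)) // size_prod_XsubC szs.
set V := \matrix_(i < k, l < k) (zs`_l) ^+ (k - i.+1).
have uV : V \in unitmx by exact: vandermonde_unit.
have -> : B = \sum_(l < k) B *m kron_col n (Vvec k zs`_l) *m
    kron_row n (row l (invmx V)).
  rewrite -[LHS]mulmx1; under eq_bigr do rewrite -mulmxA.
  rewrite -mulmx_sumr; congr (_ *m _).
  apply/matrixP => I J; case: (mxtens_indexP I) => i p; case: (mxtens_indexP J) => j q.
  have := mulmxV uV => /matrixP/(_ i j); rewrite !mxE => VV.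
  rewrite (can_eq (@mxtens_indexK k n)) xpair_eqE -mulnb natrM -VV summxE mulr_suml.
  apply: eq_bigr => l _; rewrite [RHS]mxE (bigD1 p) //= kron_colE kron_rowE.
  rewrite !mxE eqxx mulr1 big1 ?addr0.
    by rewrite mulrA.
  by move=> r rp; rewrite kron_colE eq_sym (negPf rp) mulr0 mul0r.
have -> : (k * \rank (mxfrac P) = \sum_(l < k) \rank (mxfrac P))%N.
  by rewrite sum_nat_const card_ord.
elim/big_ind2: _ => [|A a A' a' leA leA'|l _]; first by rewrite mxrank0.
  exact: leq_trans (mxrank_add _ _) (leq_add leA leA').
apply: leq_trans (mxrankM_maxl _ _) _.
have zl : zs`_l \in zs by rewrite mem_nth // szs.
have uE : u = ('X - (zs`_l)%:P) * (u %/ ('X - (zs`_l)%:P)).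
  rewrite mulrC divpK // dvdp_XsubCl rootE hornerZ.
  by have := root_prod_XsubC zs zs`_l; rewrite zl rootE => /eqP ->; rewrite mulr0.
rewrite /B uE bezout_mx_kron_col_root -?uE //.
exact: leq_trans (mxrankM_maxr _ _) (rank_mxeval_le _ _).
Qed.

(** The Bezoutian of [u + s w] is affine in [s]: its rank at [s = 0] is at most the generic rank,
    which is attained at some [s] giving simple roots. *)
Lemma rank_bezout_mx_le u : (size u <= k.+1)%N ->
  (\rank (bezout_mx k P u) <= k * \rank (mxfrac P))%N.
Proof.
move=> su; have [w [d [sw d0 simple]]] := simple_roots_perturbation su.
pose Q := mxconst (bezout_mx k P u) + 'X *: mxconst (bezout_mx k P w).
have Qs s : mxeval Q s = bezout_mx k P (u + s *: w).
  by apply/matrixP => i j; rewrite bezout_mxD !mxE !hornerE.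
have -> : bezout_mx k P u = mxeval Q 0 by rewrite Qs scale0r addr0.
apply: leq_trans (rank_mxeval_le _ _) _.
have [s ds <-] := rank_mxfrac_eval Q d0; rewrite Qs.
by have [c [zs [uzs szs ->]]] := simple s ds; exact: rank_bezout_mx_simple_roots.
Qed.

End Fixed.
End UpperBound.

(** * Root polynomials *)

Section RootPolys.
Variable F : closedFieldType.

(** Use [P(x) = x^k (rev P)(1/x)] at a nonzero [x] where [P] attains its generic rank. *)
Lemma mxrank_rev_ge (k m n : nat) (P : 'M[{poly F}]_(m, n)) : has_grade k P ->
  (\rank (mxfrac P) <= \rank (mxfrac (mxrev k P)))%N.
Proof.
move=> gradeP; have [x x0 <-] := rank_mxfrac_eval P (monic_neq0 (monicX F)).
rewrite hornerX in x0; apply: leq_trans (rank_mxeval_le _ x^-1).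
suff -> : mxeval P x = x ^+ k *: mxeval (mxrev k P) x^-1.
  by rewrite mxrank_scale_nz ?expf_neq0.
apply/matrixP => i j; rewrite !mxE horner_poly (horner_coef_wide x (gradeP i j)).
rewrite mulr_sumr [LHS](reindex_inj rev_ord_inj) /=; apply: eq_bigr => l _.
have ll : (l <= k)%N by have := ltn_ord l.
have xk : x ^+ k = x ^+ (k - l) * x ^+ l by rewrite -exprD subnK.
by rewrite subSS mulrCA xk -mulrA -exprMn divff // expr1n mulr1.
Qed.

(* Coefficients are indexed by [nat] so that sequences whose sizes are only
   propositionally equal can be compared. *)
Definition mod_free (b p : nat) (N : 'M[F]_(b, p)) (vs : seq 'cV[F]_b) : Prop :=
  forall (c : nat -> F) (a : 'cV_p),
    \sum_(j < size vs) c j *: vs`_j = N *m a ->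
    forall j, (j < size vs)%N -> c j = 0.

Lemma mod_free_take (b p : nat) (N : 'M[F]_(b, p)) vs i :
  mod_free N vs -> mod_free N (take i vs).
Proof.
move=> free c a eqc j jt.
have st : (size (take i vs) <= size vs)%N by rewrite size_take_min geq_minr.
pose c' j := if (j < size (take i vs))%N then c j else 0.
suff : c' j = 0 by rewrite /c' jt.
apply: (free c' a); last exact: leq_trans jt st.
rewrite -eqc -(big_mkord xpredT (fun j => c' j *: vs`_j)).
rewrite -(big_mkord xpredT (fun j => c j *: (take i vs)`_j)).
rewrite (big_cat_nat _ st) //= [X in _ + X]big_nat [X in _ + X]big1 ?addr0.
  rewrite !big_nat; apply: eq_bigr => l /andP[_ lt]; rewrite /c' lt nth_take //.
  by apply: leq_trans lt _; rewrite size_take_min geq_minl.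
by move=> l /andP[ge _]; rewrite /c' ltnNge ge /= scale0r.
Qed.

Lemma lam_independentP (b p : nat) (M : 'M[{poly F}]_(b, p)) lam rs :
  \rank (mxeval M lam) = p ->
  lam_independent lam M rs <->
  mod_free (mxeval M lam) [seq mxeval r lam | r <- rs].
Proof.
move=> rM; have /mxrank_eq_colP injM := rM.
rewrite /lam_independent; set R := \matrix_(i, j) _.
have RE (c : 'cV_(size rs)) :
    R *m c = \sum_(j < size rs) c j 0 *: [seq mxeval r lam | r <- rs]`_j.
  apply/colP => i; rewrite mxE summxE; apply: eq_bigr => j _.
  by rewrite !mxE (nth_map 0) // mxE mulrC.
split=> [/eqP/mxrank_eq_colP inj | free].
  move=> c a; rewrite size_map => eqc j js.
  pose C := \col_(j < size rs) c j.
  have /(inj _) : row_mx (mxeval M lam) R *m col_mx (- a) C = 0.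
    rewrite mul_row_col mulmxN RE -eqc addrC.
    by apply/eqP; rewrite subr_eq0; apply/eqP; apply: eq_bigr => l _; rewrite mxE.
  by rewrite -col_mx0 => /eq_col_mx[_ /colP/(_ (Ordinal js))]; rewrite !mxE.
apply/eqP/mxrank_eq_colP => x; rewrite -[x]vsubmxK mul_row_col => eq0.
set a := usubmx x in eq0 *; set C := dsubmx x in eq0 *.
pose c j := if insub j is Some l then C l 0 else 0.
have C0 : C = 0.
  apply/colP => l; rewrite [RHS]mxE.
  have -> : C l 0 = c l by rewrite /c valK.
  apply: (free c (- a)); last by rewrite size_map.
  rewrite size_map mulmxN (addr0_eq eq0) RE.
  by apply: eq_bigr => j _; rewrite /c valK.
by move: eq0; rewrite C0 mulmx0 addr0 => /injM ->; rewrite col_mx0.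
Qed.

Lemma in_ker_atP (b p : nat) (M : 'M[{poly F}]_(b, p)) lam u :
  reflect (exists a, u = mxeval M lam *m a) (in_ker_at lam M u).
Proof.
apply: (iffP submxP) => [[D e]|[a ->]].
  by exists D^T; apply: trmx_inj; rewrite e trmx_mul trmxK.
by exists a^T; rewrite trmx_mul.
Qed.

Lemma XsubC_order (b : nat) (y : 'cV[{poly F}]_b) x : y != 0 ->
  exists l (w : 'cV[{poly F}]_b), y = ('X - x%:P) ^+ l *: w /\ mxeval w x != 0.
Proof.
move=> y0; have [i yi] : exists i, y i 0 != 0.
  apply/existsP; apply: contraNT y0; rewrite negb_exists => /forallP y0.
  by apply/eqP/colP => i; rewrite mxE; apply/eqP/negPn/y0.
have [s] := ubnP (size (y i 0)); elim: s y {y0} yi => // s IH y yi sy.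
have [yx0|yx] := eqVneq (mxeval y x) 0; last first.
  by exists 0, y; rewrite expr0 scale1r.
have [y1 yE] : exists y1, y = ('X - x%:P) *: y1.
  by eexists; exact: polymx_divX.
have yiE : y i 0 = y1 i 0 * ('X - x%:P) by rewrite yE mxE mulrC.
have y1i : y1 i 0 != 0 by apply: contraNneq yi => y1i; rewrite yiE y1i mul0r.
have [|l [w [y1E wx]]] := IH y1 y1i.
  have := size_Mmonic y1i (monicXsubC x); rewrite -yiE size_XsubC addn2 /= => e.
  by move: sy; rewrite e.
by exists l.+1, w; rewrite yE y1E scalerA exprS.
Qed.

(** * Comparison of [P] and its pencil under the disjointness hypothesis *)

Section Recovery.
Variables (m n k : nat) (P : 'M[{poly F}]_(m, n)).
Variables (omega : 'cV[F]_k) (v : {poly F}) (L : 'M[{poly F}]_(k * m, k * n)).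
Hypotheses (hk : (2 <= k)%N) (hP : has_grade k P).
Hypothesis hv : v = ((mxconst omega)^T *m Vvec k 'X) 0 0.
Hypotheses (hv0 : v != 0) (hL : isDL P v L).
Hypothesis hdisj : forall mu : option F,
  ~~ (poly_eigenvalue k P mu && grade_root k.-1 v mu).

Let r := \rank (mxfrac P).

Lemma ansatz_poly : v = \poly_(a < k)
  (if insub (k - a.+1)%N is Some i then omega i 0 else 0).
Proof.
rewrite hv mxE poly_def [RHS](reindex_inj rev_ord_inj) /=.
apply: eq_bigr => i _; rewrite !mxE mul_polyC.
have e : (k - (k - i.+1).+1 = i)%N by have := ltn_ord i; lia.
by rewrite e valK.
Qed.

Lemma size_ansatz : (size v <= k)%N.
Proof. by rewrite ansatz_poly size_poly. Qed.

Lemma coefvec_ansatz : coefvec k v = omega.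
Proof.
apply/colP => i; rewrite mxE ansatz_poly coef_poly.
have e : (k - (k - i.+1).+1 = i)%N by have := ltn_ord i; lia.
by rewrite ifT ?e ?valK //; have := ltn_ord i; lia.
Qed.

Lemma DL_eval z : mxeval L z = bezout_mx k P (('X - z%:P) * v).
Proof. by apply: isDL_bezout_mx => //; [lia | exact: size_ansatz]. Qed.

Lemma size_XsubC_ansatz z : (size (('X - z%:P) * v)%R <= k.+1)%N.
Proof.
apply: leq_trans (size_polyMleq _ _) _.
by rewrite size_XsubC addSn add1n ltnS size_ansatz.
Qed.

Lemma mxeval_kron_row (a b : nat) (u : 'rV[{poly F}]_a) z :
  mxeval (kron_row b u) z = kron_row b (mxeval u z).
Proof. exact: (map_mx_kron_row (horner_eval z)). Qed.

Lemma mxeval_kron_col (a b : nat) (u : 'cV[{poly F}]_a) z :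
  mxeval (kron_col b u) z = kron_col b (mxeval u z).
Proof. exact: (map_mx_kron_col (horner_eval z)). Qed.

Lemma mxeval_Vvec (a : nat) (z : F) : mxeval (Vvec a 'X) z = Vvec a z.
Proof.
rewrite -[z in RHS](hornerX z); exact: (map_mx_Vvec (horner_eval z)).
Qed.

Lemma mxeval_tr (a b : nat) (A : 'M[{poly F}]_(a, b)) z :
  mxeval A^T z = (mxeval A z)^T.
Proof. by apply/matrixP => i j; rewrite !mxE. Qed.

Let Phi := kron_row n (mxconst omega)^T.
Let Pi : 'M[{poly F}]_(k * n, n) := kron_col n (Vvec k 'X).
Let Omega := kron_col m (mxconst omega).
Let Psi : 'M[{poly F}]_(m, k * m) := kron_row m (Vvec k 'X)^T.

(** At each [z] this is the factorization at the root [z] of [('X - z%:P) * v], whose cofactor [v]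
    has coefficient vector [omega]. *)
Lemma DL_left_ansatz : Psi *m L = P *m Phi.
Proof.
apply: eq_mxeval => z; rewrite !mxevalM !mxeval_kron_row !mxeval_tr mxeval_Vvec.
rewrite mxeval_const DL_eval.
by rewrite kron_row_bezout_mx_root ?size_XsubC_ansatz // coefvec_ansatz.
Qed.

Lemma DL_right_ansatz : L *m Pi = Omega *m P.
Proof.
apply: eq_mxeval => z; rewrite !mxevalM !mxeval_kron_col mxeval_Vvec.
rewrite mxeval_const DL_eval.
by rewrite bezout_mx_kron_col_root ?size_XsubC_ansatz // coefvec_ansatz.
Qed.

Lemma Phi_Pi : Phi *m Pi = v%:M.
Proof.
apply/matrixP => p q; rewrite mul_kron_row !mxE hv mxE -sumrMnl.
apply: eq_bigr => i _; rewrite kron_colE !mxE mulr_natr.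
by rewrite mulrnAr.
Qed.

Lemma rank_DL_le : (\rank (mxfrac L) <= k * r)%N.
Proof.
have [x _ <-] := rank_mxfrac_eval L (oner_neq0 _).
by rewrite DL_eval rank_bezout_mx_le ?size_XsubC_ansatz.
Qed.

(** The lower Bezoutian bound for [('X - lam%:P) * v]: by disjointness, each of the [k - 1] roots of
    [v], infinity included, contributes at most the generic nullity [n - r]. *)
Lemma rank_DL_eval_ge lam :
  (k * n <= \rank (mxeval L lam) + (n - \rank (mxeval P lam) + k.-1 * (n - r)))%N.
Proof.
have [zs vE] := closed_field_poly_normal v.
have lv : lead_coef v != 0 by rewrite lead_coef_eq0.
have szs : size v = (size zs).+1.
  by rewrite {1}vE size_scale // size_prod_XsubC.
have uE : ('X - lam%:P) * v = lead_coef v *: \prod_(z <- lam :: zs) ('X - z%:P).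
  by rewrite big_cons {1}vE scalerAr.
have slz : (size (lam :: zs) <= k)%N by rewrite /= -szs size_ansatz.
have := rank_bezout_mx_ge hP lv slz; rewrite -uE -DL_eval => ge.
apply: leq_trans ge _; rewrite leq_add2l big_cons -addnA leq_add2l.
have -> : (k.-1 * (n - r) = \sum_(z <- zs) (n - r)
    + (k - size (lam :: zs)) * (n - r))%N.
  rewrite big_const_seq count_predT iter_addn_0 [X in (X + _)%N]mulnC -mulnDl.
  by congr (_ * _)%N; move: slz => /=; lia.
apply: leq_add.
  rewrite !big_seq; apply: leq_sum => z zzs; apply: leq_sub2l.
  have := hdisj (Some z); rewrite /= {1}vE rootZ // root_prod_XsubC zzs andbT.
  by rewrite /finite_eigenvalue -leqNgt.
(* A positive defect means [deg v < k - 1], so infinity is a root of [v] and therefore no eigenvalue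
   of [P]. *)
case: (posnP (k - size (lam :: zs))) => [->|e0]; first by rewrite !mul0n.
rewrite leq_mul2l; apply/orP; right; apply: leq_sub2l.
have := hdisj None; rewrite /= szs /=.
have -> : (size zs < k.-1)%N by move: e0 => /=; lia.
rewrite andbT /finite_eigenvalue -leqNgt; apply: leq_trans.
exact: mxrank_rev_ge.
Qed.

Variable lam : F.

Section WithBases.
Variables (pP pL : nat).
Variables (MP : 'M[{poly F}]_(n, pP)) (ML : 'M[{poly F}]_(k * n, pL)).
Hypotheses (minP : right_minimal_basis P MP) (minL : right_minimal_basis L ML).

Let rMP : \rank (mxeval MP lam) = pP := rank_minimal_basis lam minP.
Let rML : \rank (mxeval ML lam) = pL := rank_minimal_basis lam minL.

Lemma size_basisP : pP = (n - r)%N.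
Proof. exact: ker_poly_basis_size (proj1 minP). Qed.

Lemma size_basisL_ge : (pP + k.-1 * pP <= pL)%N.
Proof.
rewrite -mulSn prednK; last exact: ltnW.
rewrite size_basisP (ker_poly_basis_size (proj1 minL)) mulnBr.
exact/leq_sub2l/rank_DL_le.
Qed.

Lemma rank_ker_DL_le :
  (\rank (kermx (mxeval L lam)^T) <= \rank (kermx (mxeval P lam)^T) + k.-1 * pP)%N.
Proof.
rewrite !mxrank_ker !mxrank_tr size_basisP leq_subLR.
exact: rank_DL_eval_ge.
Qed.

(** From [P Phi ML = Psi L ML = 0]: thus [Phi(lam)] sends [ker_lam L] into [ker_lam P]. *)
Lemma basisL_Phi : exists G, mxeval Phi lam *m mxeval ML lam = mxeval MP lam *m G.
Proof.
have [_ LM0 _] := (ker_poly_basisP L ML).1 (proj1 minL).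
have PX0 : P *m (Phi *m ML) = 0 by rewrite mulmxA -DL_left_ansatz -mulmxA LM0 mulmx0.
have [G e] := kernel_eval_sub_basis lam minP PX0.
by exists G; rewrite -mxevalM.
Qed.

(** * The case where [lam] is not a root of [v] *)

Section NonRoot.
Hypothesis vlam : v.[lam] != 0.

(** As the scalar is constant, [Phi] maps the lift to [v / v(lam)] times [x], which need agree with
    [x] only at [lam]. *)
Let lift (x : 'cV[{poly F}]_n) : 'cV[{poly F}]_(k * n) :=
  (v.[lam]^-1)%:P *: (Pi *m x).

Lemma mxeval_lift x : mxeval Phi lam *m mxeval (lift x) lam = mxeval x lam.
Proof.
rewrite -mxevalM -scalemxAr mulmxA Phi_Pi mul_scalar_mx scalerA mxevalZ.
by rewrite hornerM hornerC mulVf // scale1r.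
Qed.

(** In transposed form, [S] holds the vectors of [ker L(lam)] that [Phi(lam)] sends into
    [ker_lam P], and [T] those that it sends to zero. *)
Let K := kermx (mxeval L lam)^T.
Let f := (mxeval Phi lam)^T.
Let N := (mxeval MP lam)^T.
Let S := (K :&: kermx (f *m cokermx N))%MS.
Let T := (K :&: kermx f)%MS.

(** By [L Pi = Omega P], the matrix [Pi(lam)] maps [ker P(lam)] into [ker L(lam)], and [Phi(lam)]
    undoes it up to [v(lam)]; so [Phi(lam)] maps [ker L(lam)] onto at least [ker P(lam)]. *)
Lemma rank_KT_ge : (\rank (kermx (mxeval P lam)^T) + \rank T <= \rank K)%N.
Proof.
rewrite -(mxrank_mul_ker K f) leq_add2r; apply: mxrankS.
apply/rV_subP => y /sub_kermxP Py.
have Py0 : mxeval P lam *m y^T = 0.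
  by apply: trmx_inj; rewrite trmx_mul trmxK Py trmx0.
pose x : 'cV_n := v.[lam]^-1 *: y^T.
have Lx : mxeval L lam *m (mxeval Pi lam *m x) = 0.
  rewrite mulmxA -mxevalM DL_right_ansatz mxevalM -mulmxA -scalemxAr Py0.
  by rewrite scaler0 mulmx0.
have -> : y = (mxeval Pi lam *m x)^T *m f.
  rewrite /f -trmx_mul mulmxA -mxevalM Phi_Pi.
  have -> : mxeval (v%:M : 'M_n) lam = v.[lam]%:M.
    by apply/matrixP => i j; rewrite !mxE hornerMn.
  by rewrite mul_scalar_mx scalerA divff // scale1r trmxK.
apply: submxMr; apply/sub_kermxP; apply: trmx_inj.
by rewrite -trmx_mul trmxK Lx trmx0.
Qed.

Lemma rank_S_le : (\rank S <= pP + \rank T)%N.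
Proof.
rewrite -(mxrank_mul_ker S f); apply: leq_add.
  rewrite -rMP -[X in (_ <= X)%N]mxrank_tr; apply: mxrankS.
  rewrite submxE -mulmxA; apply/eqP/sub_kermxP; exact: capmxSr.
by apply: mxrankS; apply: capmxS (capmxSl _ _) (submx_refl _).
Qed.

Lemma basisL_sub_S : ((mxeval ML lam)^T <= S)%MS.
Proof.
have [_ LM0 _] := (ker_poly_basisP L ML).1 (proj1 minL).
rewrite sub_capmx; apply/andP; split; apply/sub_kermxP.
  by rewrite -trmx_mul -mxevalM LM0; apply/matrixP => i j; rewrite !mxE horner0.
have [G e] := basisL_Phi.
by rewrite mulmxA /f -trmx_mul e trmx_mul -mulmxA mulmx_coker mulmx0.
Qed.

(** Sandwich: [pL <= rank S <= pP + rank T <= pP + rank K - dim ker P(lam) <= k pP <= pL]. *)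
Lemma rank_basisL_S : \rank S = pL.
Proof.
have := mxrankS basisL_sub_S; rewrite mxrank_tr rML => leS.
have := rank_S_le; have := rank_KT_ge; have := rank_ker_DL_le; have := size_basisL_ge.
rewrite -/K; lia.
Qed.

Lemma kernel_Phi_sub_basisL (x : 'cV[F]_(k * n)) a :
  mxeval L lam *m x = 0 -> mxeval Phi lam *m x = mxeval MP lam *m a ->
  exists b, x = mxeval ML lam *m b.
Proof.
move=> Lx Phix; apply/in_ker_atP; rewrite /in_ker_at.
have eqS : ((mxeval ML lam)^T == S)%MS.
  by rewrite -(mxrank_leqif_eq basisL_sub_S) mxrank_tr rML rank_basisL_S.
rewrite (eqmxP eqS) sub_capmx; apply/andP; split; apply/sub_kermxP.
  by rewrite -trmx_mul Lx trmx0.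
by rewrite mulmxA /f -trmx_mul Phix trmx_mul -mulmxA mulmx_coker mulmx0.
Qed.

(** The same chain consists of equalities; hence complete sets at [lam] have equally many elements
    for [L] and for [P]. *)
Lemma rank_ker_DL_eq :
  (\rank K + pP = \rank (kermx (mxeval P lam)^T) + pL)%N.
Proof.
have := rank_basisL_S; have := rank_S_le; have := rank_KT_ge.
have := rank_ker_DL_le; have := size_basisL_ge.
rewrite -/K; lia.
Qed.

Lemma mod_free_lift vs :
  mod_free (mxeval MP lam) [seq mxeval Phi lam *m x | x <- vs] ->
  mod_free (mxeval ML lam) vs.
Proof.
have [G e] := basisL_Phi; move=> free c a eqc j js.
apply: (free c (G *m a)); last by rewrite size_map.
rewrite size_map mulmxA -e -mulmxA -eqc mulmx_sumr.
by apply: eq_bigr => i _; rewrite (nth_map 0) // scalemxAr.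
Qed.

Lemma mod_free_Phi vs : (forall x, x \in vs -> mxeval L lam *m x = 0) ->
  mod_free (mxeval ML lam) vs ->
  mod_free (mxeval MP lam) [seq mxeval Phi lam *m x | x <- vs].
Proof.
move=> Lvs free c a; rewrite size_map => eqc.
have Lx : mxeval L lam *m (\sum_(j < size vs) c j *: vs`_j) = 0.
  rewrite mulmx_sumr big1 // => j _.
  by rewrite -scalemxAr Lvs ?scaler0 // mem_nth.
have [|b eqb] := kernel_Phi_sub_basisL (a := a) Lx.
  rewrite -eqc mulmx_sumr; apply: eq_bigr => j _.
  by rewrite (nth_map 0) // scalemxAr.
exact: free eqb.
Qed.

(** The relation [L Pi = Omega P] carries the power of ['X - lam%:P] over, and [Omega] is injective
    since [omega] is nonzero, so the order is exactly [l]. *)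
Lemma root_poly_lift l x : root_poly P lam MP l x -> root_poly L lam ML l (lift x).
Proof.
case=> l1 [w Px wlam] xker; split=> //.
  exists ((v.[lam]^-1)%:P *: (Omega *m w)).
    rewrite -scalemxAr mulmxA DL_right_ansatz -mulmxA Px -scalemxAr.
    by rewrite !scalerA mulrC.
  rewrite mxevalZ hornerC scaler_eq0 invr_eq0 (negPf vlam) /= mxevalM.
  rewrite mxeval_kron_col mxeval_const; apply: contraNneq wlam => ow0.
  have [i oi] : exists i, omega i 0 != 0.
    apply/existsP; apply: contraNT hv0; rewrite negb_exists => /forallP o0.
    rewrite hv mxE big1 // => i _; have /negPn/eqP := o0 i.
    by rewrite !mxE => ->; rewrite polyC0 mul0r.
  apply/eqP/colP => p; rewrite [RHS]mxE; apply: (mulfI oi); rewrite mulr0.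
  have := congr1 (fun A : 'cV[F]_(k * m) => A (mxtens_index (i, p)) 0) ow0.
  rewrite [LHS]mxE (bigD1 p) //= kron_colE eqxx mulr1 big1 ?addr0 => [|q qp].
    by move=> ->; rewrite mxE.
  by rewrite kron_colE eq_sym (negPf qp) mulr0 mul0r.
apply: contraNN xker => /in_ker_atP[b eqb]; apply/in_ker_atP.
have [G e] := basisL_Phi; exists (G *m b).
by rewrite -mxeval_lift eqb mulmxA e mulmxA.
Qed.

Lemma root_poly_kernel l x : root_poly L lam ML l x -> mxeval L lam *m mxeval x lam = 0.
Proof.
case=> l1 [w Lx _] _; rewrite -mxevalM Lx mxevalZ horner_exp hornerXsubC subrr.
by rewrite expr0n -[_ == _]negbK -lt0n l1 scale0r.
Qed.

(** * Transfer of maximality from the pencil to [P] *)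

Section Maximal.
Variables (ls : seq nat) (rho : seq 'cV[{poly F}]_(k * n)).
Hypotheses (ordL : ordered_root_polys L lam ML ls rho)
  (complL : complete_root_polys L lam ML rho)
  (maxL : maximal_orders L lam ML ls rho).

Let rs := [seq Phi *m x | x <- rho].
Let ev_rho := [seq mxeval x lam | x <- rho].

Let ev_rs : [seq mxeval x lam | x <- rs] = [seq mxeval Phi lam *m x | x <- ev_rho].
Proof. by rewrite -!map_comp; apply: eq_map => x /=; rewrite mxevalM. Qed.

Let ker_ev_rho x : x \in ev_rho -> mxeval L lam *m x = 0.
Proof.
case/mapP => y /(nthP 0)[i irho <-] ->; have [_ _ root_rho] := ordL.
exact: root_poly_kernel (root_rho i irho).
Qed.

Let free_rs : mod_free (mxeval MP lam) [seq mxeval x lam | x <- rs].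
Proof.
rewrite ev_rs; apply: mod_free_Phi => //.
by apply/lam_independentP => //; case: complL.
Qed.

(** Otherwise [lift x] would contradict the maximality of [rho]. It is appended to the original
    [rho_j], because [mod_free_lift] only asks that the images under [Phi(lam)] be independent. *)
Lemma order_bound i l x : (i < size rho)%N -> root_poly P lam MP l x ->
  mod_free (mxeval MP lam) [seq mxeval y lam | y <- rcons (take i rs) x] ->
  (l <= nth 0%N ls i)%N.
Proof.
move=> irho rootx free; rewrite leqNgt; apply/negP => lt_l.
apply: (maxL irho); exists l, (lift x); split=> //; first exact: root_poly_lift.
apply/lam_independentP => //; apply: mod_free_lift.
move: free; rewrite !map_rcons mxeval_lift !map_take ev_rs.
by [].
Qed.

(** A priori [Psi w] may vanish at [lam] to some order [l], which would raise the order of the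
    image; [order_bound], applied to the image itself, gives [l = 0]. *)
Lemma root_poly_Phi i : (i < size rho)%N ->
  root_poly P lam MP (nth 0%N ls i) (nth 0 rs i).
Proof.
move=> irho; have [_ _ /(_ i irho) rooti] := ordL.
have [l1 [w Lx wlam] xker] := rooti.
have rsE : nth 0 rs i = Phi *m rho`_i by rewrite (nth_map 0).
have rker : ~~ in_ker_at lam MP (mxeval (nth 0 rs i) lam).
  apply: contraNN xker => /in_ker_atP[a]; rewrite rsE mxevalM => eqa.
  by apply/in_ker_atP; exact: kernel_Phi_sub_basisL (root_poly_kernel rooti) eqa.
have Pr : P *m nth 0 rs i = ('X - lam%:P) ^+ nth 0%N ls i *: (Psi *m w).
  by rewrite rsE mulmxA -DL_left_ansatz -mulmxA Lx -scalemxAr.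
have Psiw0 : Psi *m w != 0.
  apply: contraNneq rker => Psiw0; apply/in_ker_atP.
  by apply: kernel_eval_sub_basis minP _; rewrite Pr Psiw0 scaler0.
have [l [w' [Psiw w'lam]]] := XsubC_order lam Psiw0.
have root_l : root_poly P lam MP (nth 0%N ls i + l) (nth 0 rs i).
  split=> //; first by rewrite addn_gt0 l1.
  by exists w'; rewrite // Pr Psiw scalerA exprD.
have : (nth 0%N ls i + l <= nth 0%N ls i)%N.
  apply: (order_bound irho root_l).
  by rewrite -take_nth ?size_map //; rewrite map_take; exact: mod_free_take.
rewrite -{2}[nth 0%N ls i]addn0 leq_add2l leqn0 => /eqP l0.
by rewrite l0 addn0 in root_l.
Qed.

Lemma maximal_root_polys_Phi : maximal_root_polys P lam rs.
Proof.
have [szls sls _] := ordL; have [_ szL] := complL.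
exists pP, MP, ls; split=> //.
- split=> //; first by rewrite size_map.
  by move=> i; rewrite size_map; exact: root_poly_Phi.
- split; first exact/lam_independentP.
  rewrite size_map rMP; have := rank_ker_DL_eq; rewrite rML in szL.
  by rewrite /K -szL addnAC => /addIn.
- move=> i; rewrite size_map => irho [l [x [rootx /lam_independentP free lt_l]]].
  have := order_bound irho rootx (free rMP); lia.
Qed.

End Maximal.
End NonRoot.

(** Here [lam] is no eigenvalue of [P], so [ker P(lam)] has dimension [pP], and
    [dim ker L(lam) <= k pP <= pL] leaves no room for a root polynomial in [rho]. *)
Lemma maximal_root_polys_root (rho : seq 'cV[{poly F}]_(k * n)) :
  v.[lam] = 0 -> complete_root_polys L lam ML rho ->
  rho = [::] /\ maximal_root_polys P lam [::].
Proof.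
move=> vlam [_]; rewrite rML => szrho.
have eigP : pP = \rank (kermx (mxeval P lam)^T).
  have := hdisj (Some lam); rewrite /= rootE vlam eqxx andbT /finite_eigenvalue.
  rewrite -leqNgt => le; rewrite mxrank_ker mxrank_tr size_basisP.
  by congr (_ - _)%N; apply/eqP; rewrite eqn_leq le rank_mxeval_le.
split.
  apply/size0nil; have := rank_ker_DL_le; have := size_basisL_ge.
  rewrite -szrho -eigP => leL geL; apply/eqP.
  by have := leq_trans geL leL; rewrite -[X in (_ <= X)%N -> _]add0n leq_add2r leqn0.
exists pP, MP, [::]; split=> //.
split; last by rewrite rMP -eigP.
by apply/lam_independentP => //= c a _ j.
Qed.

End WithBases.

End Recovery.
End RootPolys.

Theorem theorem6p10 (F : closedFieldType) (char0 : [pchar F] =i pred0)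
    (m n k : nat) (hk : (2 <= k)%N)
    (P : 'M[{poly F}]_(m, n)) (hP : has_grade k P)
    (omega : 'cV[F]_k) (v : {poly F})
    (hv : v = ((mxconst omega)^T *m Vvec k 'X) 0 0) (hv0 : v != 0)
    (L : 'M[{poly F}]_(k * m, k * n)) (hL : isDL P v L)
    (hdisj : forall mu : option F,
       ~~ (poly_eigenvalue k P mu && grade_root k.-1 v mu))
    (lam : F) (t : nat) (rho : t.-tuple 'cV[{poly F}]_(k * n))
    (hrho : maximal_root_polys L lam rho) :
  maximal_root_polys P lam
    [seq kron_row n (mxconst omega)^T *m rho_i | rho_i <- rho].
Proof.
have [pL [ML [ls [minL ordL complL maxL]]]] := hrho.
have [pP [MP minP]] := right_minimal_basis_exists P.
have [vlam | vlam] := eqVneq v.[lam] 0; last first.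
  exact: (maximal_root_polys_Phi hk hP hv hv0 hL hdisj minP minL vlam ordL complL maxL).
have [-> //] := maximal_root_polys_root hk hP hv hv0 hL hdisj minP minL vlam complL.
Qed.
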